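(* Let $r_1 = \limsup_{g \to \infty} s_g^{1/g}$ and $r_2 = \limsup_{g \to \infty} \hat n_g^{1/g}$. Then $\mathsf{r}_{1.51} \leq r_1 \leq r_2 \leq \mathsf{r}_{1.54}$.
   Context: A numerical semigroup $\Lambda$ is an additive submonoid of the nonnegative integers $\mathbb{N}_0$ with finite complement $\mathbb{N}_0 \setminus \Lambda$. Its genus is $g(\Lambda) = |\mathbb{N}_0 \setminus \Lambda|$, its multiplicity is $m(\Lambda) = \min(\Lambda \setminus \{0\})$, its conductor is $c(\Lambda) = \min\{c \in \mathbb{N}_0 : c + \mathbb{N}_0 \subseteq \Lambda\}$, and its depth is $q(\Lambda) = \lceil c(\Lambda)/m(\Lambda) \rceil$. Let $n_g$ be the number of numerical semigroups of genus $g$, let $t_g$ be the number of numerical semigroups of genus $g$ with depth $q \leq 3$, let $\hat n_g = n_g - t_g$ be the number of numerical semigroups of genus $g$ with depth $q > 3$, and let $s_g = t_g - t_{g-1} - t_{g-2}$ for $g \ge 3$ (with $s_0 = s_1 = s_2 = 0$). The constants $\mathsf{r}_{1.51} \approx 1.51519$ and $\mathsf{r}_{1.54} \approx 1.54930$ are defined so that $1/\mathsf{r}_{1.51}$ and $1/\mathsf{r}_{1.54}$ are the unique positive zeros of the polynomials $x^3(x+1)(x^2+x+1) - 1$ and $x^4(x+1)^2(x^4+2x^3+x^2+1) - 1$, respectively. *)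

(* Defs.v *)
From HB Require Import structures.
From mathcomp Require Import all_boot all_order all_algebra finmap.
From mathcomp Require Import all_classical all_reals all_analysis.
From mathcomp Require Import zify ring lra.

Set Implicit Arguments.
Unset Strict Implicit.
Unset Printing Implicit Defensive.

Import Order.TTheory GRing.Theory Num.Theory.
Local Open Scope classical_set_scope.
Local Open Scope ring_scope.

(* Meaningful for nonempty [A]; see [set_minP]. *)
Definition set_min (A : set nat) : nat :=
  xget 0%N [set n | A n /\ forall k, A k -> (n <= k)%N].

Lemma set_minP (A : set nat) : A !=set0 ->
  A (set_min A) /\ forall k, A k -> (set_min A <= k)%N.
Proof.
move=> [a Aa]; rewrite /set_min; case: xgetP => [n _ //|nomin].
have exA : exists n, `[< A n >] by exists a; apply/asboolP.
case: (ex_minnP exA) => m /asboolP Am minm.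
by case: (nomin m); split=> // k Ak; apply: minm; apply/asboolP.
Qed.

(* Cardinality of a finite set (0 on infinite sets). *)
Definition ncard (T : choiceType) (A : set T) : nat := #|` fset_set A|.

Definition numerical_semigroup (S : set nat) : Prop :=
  [/\ S 0%N, forall x y, S x -> S y -> S (x + y)%N & finite_set (~` S)].

Definition genus (S : set nat) : nat := ncard (~` S).

Definition multiplicity (S : set nat) : nat := set_min (S `\ 0%N).

Definition conductor (S : set nat) : nat :=
  set_min [set c | forall n, S (c + n)%N].

Definition depth (S : set nat) : int :=
  Num.ceil ((conductor S)%:R / (multiplicity S)%:R : rat).

Definition semigroups_of_genus (g : nat) : set (set nat) :=
  [set S | numerical_semigroup S /\ genus S = g].

(* Every gap of a numerical semigroup of genus g is < 2g, so [ncard] below is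
   only applied to finite sets. *)
Lemma finite_semigroups_of_genus (g : nat) : finite_set (semigroups_of_genus g).
Proof.
pose F (X : {set 'I_g.*2.+1}) : set nat :=
  [set n | forall i : 'I_g.*2.+1, i = n :> nat -> i \notin X].
apply: (@sub_finite_set _ _ (range F)); last exact: finite_image.
move=> S [[S0 Sadd finS] gS].
have gap_lt h : ~ S h -> (h < g.*2.+1)%N.
  move=> Sh; pose G := fset_set (~` S).
  have cG : size (enum_fset G) = g by rewrite -gS.
  have inG n : (n \in enum_fset G) = (n \in ~` S) by rewrite -in_fset_set.
  have sub : {subset iota 0 h.+1
      <= enum_fset G ++ [seq (h - n)%N | n <- enum_fset G]}.
    move=> n; rewrite mem_iota add0n ltnS /= => nh; rewrite mem_cat.
    have [Sn|nSn] := pselect (S n).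
      apply/orP; right; apply/mapP; exists (h - n)%N; last by lia.
      rewrite inG inE /= => Shn; apply: Sh.
      by rewrite -(subnKC nh); apply: Sadd.
    by rewrite inG mem_set.
  have := uniq_leq_size (iota_uniq 0 h.+1) sub.
  by rewrite size_iota size_cat size_map cG; lia.
exists [set i : 'I_g.*2.+1 | `[< ~ S i >]]%SET => //.
apply/seteqP; split=> n /=.
  rewrite /F /= => Fn; apply: contrapT => nSn.
  by have := Fn (Ordinal (gap_lt n nSn)) erefl; rewrite inE => /asboolP.
by move=> Sn i iE; rewrite inE iE; apply/asboolP => /(_ Sn).
Qed.

Definition n_ (g : nat) : nat := ncard (semigroups_of_genus g).

Definition t_ (g : nat) : nat :=
  ncard (semigroups_of_genus g `&` [set S | depth S <= 3]).

Definition nhat_ (g : nat) : int := (n_ g)%:Z - (t_ g)%:Z.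

Definition s_ (g : nat) : int :=
  if (g < 3)%N then 0 else (t_ g)%:Z - (t_ (g - 1))%:Z - (t_ (g - 2))%:Z.

(* limsup_{g -> oo} (u g)^{1/g}, for u >= 0. The limsup is taken in the extended
   reals, so that no boundedness is presupposed. At a negative base, [powR]
   returns the junk value 1. *)
Definition limsup_root (R : realType) (u : nat -> int) : \bar R :=
  limn_esup (fun g => (((u g)%:~R : R) `^ (g%:R^-1))%:E).

Definition is_unique_pos_zero (R : realType) (p : {poly R}) (x : R) : Prop :=
  [/\ 0 < x, root p x & forall y, 0 < y -> root p y -> y = x].

Definition pos_zero (R : realType) (p : {poly R}) : R :=
  xget 0 [set x | is_unique_pos_zero p x].

Definition poly151 (R : realType) : {poly R} :=
  'X^3 * ('X + 1) * ('X^2 + 'X + 1) - 1.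

Definition poly154 (R : realType) : {poly R} :=
  'X^4 * ('X + 1) ^+ 2 * ('X^4 + 2 *: 'X^3 + 'X^2 + 1) - 1.

Definition r151 (R : realType) : R := (pos_zero (poly151 R))^-1.

Definition r154 (R : realType) : R := (pos_zero (poly154 R))^-1.

Lemma pos_zeroP (R : realType) (p : {poly R}) :
  p.[0] < 0 -> 0 <= p.[1] ->
  (forall x y, 0 < x -> x < y -> p.[x] < p.[y]) ->
  is_unique_pos_zero p (pos_zero p).
Proof.
move=> p0 p1 pmono; rewrite /pos_zero; case: xgetP => [x _ //|nox].
have p01 : p.[0] <= 0 <= p.[1] by rewrite ltW.
have [x /andP[x0 x1] px] := poly_ivt ler01 p01.
have xgt0 : 0 < x.
  rewrite lt_neqAle x0 andbT; apply/eqP => x0E.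
  by move: px p0; rewrite -x0E => /rootP ->; rewrite ltxx.
case: (nox x); split=> // y y0 py; apply/eqP; move/rootP: px => px.
move/rootP: py => py; case: ltgtP => // [yx|xy].
  by have := pmono _ _ y0 yx; rewrite px py ltxx.
by have := pmono _ _ xgt0 xy; rewrite px py ltxx.
Qed.

Lemma horner_poly151 (R : realType) (x : R) :
  (poly151 R).[x] = x ^+ 3 * (x + 1) * (x ^+ 2 + x + 1) - 1.
Proof. by rewrite /poly151 !hornerE. Qed.

Lemma horner_poly154 (R : realType) (x : R) :
  (poly154 R).[x] =
  x ^+ 4 * (x + 1) ^+ 2 * (x ^+ 4 + 2 * x ^+ 3 + x ^+ 2 + 1) - 1.
Proof. by rewrite /poly154 !hornerE /=; ring. Qed.

Lemma r151P (R : realType) : is_unique_pos_zero (poly151 R) (r151 R)^-1.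
Proof.
rewrite /r151 invrK; apply: pos_zeroP; rewrite ?horner_poly151; [lra|lra|].
move=> x y x0 xy; rewrite !horner_poly151.
have x2 : x ^+ 2 < y ^+ 2 by rewrite ltr_pXn2r // ?nnegrE; lra.
have x3 : x ^+ 3 < y ^+ 3 by rewrite ltr_pXn2r // ?nnegrE; lra.
have x2p : 0 < x ^+ 2 by rewrite exprn_gt0.
have x3p : 0 < x ^+ 3 by rewrite exprn_gt0.
rewrite ltrD2r; apply: ltr_pM; [apply: mulr_ge0; lra|lra| |lra].
by apply: ltr_pM; lra.
Qed.

Lemma r154P (R : realType) : is_unique_pos_zero (poly154 R) (r154 R)^-1.
Proof.
rewrite /r154 invrK; apply: pos_zeroP; rewrite ?horner_poly154; [lra|lra|].
move=> x y x0 xy; rewrite !horner_poly154.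
have x2 : x ^+ 2 < y ^+ 2 by rewrite ltr_pXn2r // ?nnegrE; lra.
have x3 : x ^+ 3 < y ^+ 3 by rewrite ltr_pXn2r // ?nnegrE; lra.
have x4 : x ^+ 4 < y ^+ 4 by rewrite ltr_pXn2r // ?nnegrE; lra.
have x5 : (x + 1) ^+ 2 < (y + 1) ^+ 2 by rewrite ltr_pXn2r // ?nnegrE; lra.
have x2p : 0 < x ^+ 2 by rewrite exprn_gt0.
have x3p : 0 < x ^+ 3 by rewrite exprn_gt0.
have x4p : 0 < x ^+ 4 by rewrite exprn_gt0.
have x5p : 0 < (x + 1) ^+ 2 by rewrite exprn_gt0 //; lra.
rewrite ltrD2r; apply: ltr_pM; [apply: mulr_ge0; lra|lra| |lra].
by apply: ltr_pM; lra.
Qed.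

(* Main.v *)
Require Import Defs.
From HB Require Import structures.
From mathcomp Require Import all_boot all_order all_algebra finmap.
From mathcomp Require Import all_classical all_reals all_analysis.
From mathcomp Require Import zify ring lra.
From Stdlib Require BinNat Nnat.

Set Implicit Arguments.
Unset Strict Implicit.
Unset Printing Implicit Defensive.

Import Order.TTheory GRing.Theory Num.Theory.

(** A numerical semigroup of multiplicity m is encoded by its Kunz word
    w_1 ... w_(m-1), where w_i is the number of gaps congruent to i modulo m.
    The words that occur are those with positive letters such that
    w_(i+j) <= w_i + w_j if i + j < m and w_(i+j-m) <= w_i + w_j + 1 if
    i + j > m; the genus is the sum of the letters and the depth is the largest
    letter ([semigroup_kunz], [genus_semigroup_of], [depth_semigroup_of]). All
    three inequalities thus become statements about words counted by their sum.

    When all letters are at most 3, the only condition left is that two letters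
    1 at positions i and j forbid the letter 3 at position i + j. A letter 1 or
    2 can therefore always be appended, and s_g is the number of such words of
    sum g that end in 3 ([s_stressed]); call them stressed.

    Lower bound for r_1. If u is a word of length k over {2, 3} and v a word of
    length k over {1, 2, 3}, then u v 3 is stressed: two letters 1 sit beyond
    position k, so their positions add up to more than the length. Weighting a
    word by x^sum, these words have total weight x^3 P(x)^k with
    P(x) = x^3 (x+1) (x^2+x+1), which is x^3 at x = 1/r151, while their sums take
    at most 3k + 1 values; so some g has s_g at least r151^g up to a polynomial
    factor ([r151_le]).

    Comparison of r_1 and r_2. If w = a u b 3 is stressed then 4 u is a Kunz word
    of depth 4: its wrap-around condition at the letter 4 is what the final 3
    imposes on w ([stressed_depth4]). Only a, b and a bounded amount of genus are
    lost ([s_le_nhat]).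

    Upper bound for r_2. Fix a word, let q >= 4 be its largest letter and k the
    last position of q. The Kunz conditions at k say that w_j + w_(k-j) >= q for
    j < k and w_j + w_(k+m-j) >= q - 1 for j > k, and the letters after k are at
    most q - 1 ([peaked_pair]). Hence the total weight of these words is bounded
    by a product over pairs of mirror positions ([reflection_bound]). At
    x = 71/110, which is slightly larger than 1/r154, each factor is at most 1 as
    soon as q >= 7 ([pair_sum_full_le]). For q = 4, 5, 6 a factor can exceed 1,
    and one has to use that small letters at i and j forbid a large letter at
    i + j. This is done by a covering argument ([cover_exists], [cover_card]):
    subexponentially many certificates suffice to attach to every word sets U
    and V of positions that contain all letters <= u and <= v respectively, and
    a set N on which letters are <= u + v, such that
    |U| + |V| <= |N| + (number of positions) + o(m). For a fixed certificate,
    give a position the potential y^([U] + [V] - [N] - 1); the product of all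
    potentials is subexponential, so it is enough that the weight of every mirror
    pair is at most the product of its two potentials. That is a finite list of
    numerical inequalities ([pair_sum_le12], [pair_sum_le11], [pair_sum_le4]).
    For q = 5, 6 the choice (u, v) = (1, 2) works. For q = 4 one combines
    (u, v) = (1, 1) on the whole word with (u, v) = (1, 2) before k. Altogether
    the number of words of genus g is at most (110/71)^g up to a subexponential
    factor ([ndeep_le], [peaked_sum_le]), and 110/71 < r154. *)

(** * Kunz words of numerical semigroups *)

Section KunzWords.
Local Open Scope nat_scope.

(** Positions are numbered from 1; the value 0 at position 0 makes the Kunz
    conditions uniform in the residues modulo m, including 0. *)
Definition coord (w : seq nat) (i : nat) : nat := nth 0 (0 :: w) i.

Definition kunz (w : seq nat) : bool :=
  let m := (size w).+1 in
  all (ltn 0) w &&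
  [forall i : 'I_m, forall j : 'I_m,
    ((i + j < m) ==> (coord w (i + j) <= coord w i + coord w j)) &&
    ((m <= i + j) ==> (coord w (i + j - m) <= (coord w i + coord w j).+1))].

(** The first argument is fuel; any value at least g gives the same list. *)
Fixpoint compositions_rec (n g : nat) : seq (seq nat) :=
  if g is 0 then [:: [::]] else
  if n is n'.+1 then
    flatten [seq [seq a :: w | w <- compositions_rec n' (g - a)] | a <- iota 1 g]
  else [::].

Definition compositions (g : nat) : seq (seq nat) := undup (compositions_rec g g).

Lemma mem_compositions g w : (w \in compositions g) = all (ltn 0) w && (sumn w == g).
Proof.
rewrite mem_undup.
suff H n : g <= n ->
    (w \in compositions_rec n g) = all (ltn 0) w && (sumn w == g) by exact: H.
elim: n g w => [|n IH] [|g] w gn; rewrite ?[compositions_rec _ 0]/= ?inE //.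
- by case: w => [|[|a] w] //=; rewrite addSn andbF.
- by case: w => [|[|a] w] //=; rewrite addSn andbF.
have -> : compositions_rec n.+1 g.+1 = flatten [seq
  [seq a :: w | w <- compositions_rec n (g.+1 - a)] | a <- iota 1 g.+1] by [].
apply/flatten_mapP/idP => [[a]|].
  rewrite mem_iota => /andP[a0 ag] /mapP[v].
  rewrite IH; last lia.
  by move=> /andP[pv /eqP sv] -> /=; rewrite pv a0 sv; apply/eqP; lia.
case: w => [|a w] //= /andP[/andP[a0 pw] /eqP s].
exists a; first by rewrite -[_ :: _]/(iota 1 g.+1) mem_iota; lia.
apply/mapP; exists w => //; rewrite IH; last lia.
by rewrite pw; apply/eqP; lia.
Qed.

Lemma uniq_compositions g : uniq (compositions g). Proof. exact: undup_uniq. Qed.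

Lemma kunzP (w : seq nat) : let m := (size w).+1 in
  reflect [/\ forall i, 0 < i < m -> 0 < coord w i,
    forall i j, i + j < m -> coord w (i + j) <= coord w i + coord w j &
    forall i j, i < m -> j < m -> m <= i + j ->
      coord w (i + j - m) <= (coord w i + coord w j).+1]
  (kunz w).
Proof.
move=> m; apply: (iffP andP) => [[/all_nthP pw /forallP kw]|[pw k1 k2]]; split.
- by move=> [//|i] im; apply: pw; rewrite -ltnS.
- move=> i j ij; have im : i < m by lia.
  have jm : j < m by lia.
  by have /forallP/(_ (Ordinal jm))/andP[/implyP/(_ ij)] := kw (Ordinal im).
- move=> i j im jm ij.
  by have /forallP/(_ (Ordinal jm))/andP[_ /implyP/(_ ij)] := kw (Ordinal im).
- by apply/(all_nthP 0) => i iw; apply: (pw i.+1).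
- apply/forallP => i; apply/forallP => j; apply/andP; split; apply/implyP => ij.
    exact: k1.
  by apply: k2 => //; exact: ltn_ord.
Qed.

Lemma coord_gt0 w i : all (ltn 0) w -> 0 < i <= size w -> 0 < coord w i.
Proof. by move=> /all_nthP pw; case: i => // i iw; apply: pw. Qed.

Local Open Scope classical_set_scope.

Definition semigroup_of (w : seq nat) : set nat :=
  [set n | coord w (n %% (size w).+1) <= n %/ (size w).+1].

Lemma semigroup_ofE w n :
  semigroup_of w n = (coord w (n %% (size w).+1) <= n %/ (size w).+1) :> Prop.
Proof. by []. Qed.

Definition gaps_list (w : seq nat) : seq nat :=
  [seq c * (size w).+1 + i.+1 | i <- iota 0 (size w), c <- iota 0 (coord w i.+1)].

Lemma mem_gaps_list w n : (n \in gaps_list w) <-> ~ semigroup_of w n.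
Proof.
rewrite semigroup_ofE; split.
  move=> /allpairsPdep[i [c [iw cw ->]]]; move: iw cw; rewrite !mem_iota => iw cw.
  rewrite divnMDl // modnMDl modn_small ?divn_small ?addn0; lia.
move=> /negP; rewrite -ltnNge => h.
have r0 : 0 < n %% (size w).+1 by case: (n %% _) h.
have := ltn_pmod n (ltn0Sn (size w)) => rm.
apply/allpairsPdep; exists (n %% (size w).+1).-1, (n %/ (size w).+1).
rewrite !mem_iota prednK //; split; last exact: divn_eq.
  by rewrite leq0n add0n.
by rewrite leq0n.
Qed.

Lemma uniq_gaps_list w : uniq (gaps_list w).
Proof.
apply: allpairs_uniq_dep; first exact: iota_uniq.
  by move=> i _; exact: iota_uniq.
move=> [i c] [i' c'] /allpairsPdep[i1 [c1 [iw _ [ei _]]]].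
move=> /allpairsPdep[i2 [c2 [iw' _ [ei' _]]]] /= e.
move: iw iw'; rewrite -ei -ei' !mem_iota => iw iw'.
have := congr1 (modn^~ (size w).+1) e; rewrite !modnMDl !modn_small; [|lia|lia].
move=> [ii]; have := congr1 (divn^~ (size w).+1) e.
rewrite !divnMDl // !divn_small ?addn0; [|lia|lia].
by move=> ->; rewrite ii.
Qed.

Lemma size_gaps_list w : size (gaps_list w) = sumn w.
Proof.
rewrite size_allpairs_dep.
transitivity (sumn [seq coord w i.+1 | i <- iota 0 (size w)]).
  by congr sumn; apply: eq_map => i; rewrite size_iota.
by congr sumn; rewrite -[RHS](mkseq_nth 0).
Qed.

Lemma finite_gaps w : finite_set (~` semigroup_of w).
Proof.
have -> : ~` semigroup_of w = [set` gaps_list w].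
  by apply/seteqP; split=> n /=; rewrite -mem_gaps_list.
exact: finite_seq.
Qed.

Lemma genus_semigroup_of w : genus (semigroup_of w) = sumn w.
Proof.
rewrite -size_gaps_list /genus /ncard cardfE.
have -> : ~` semigroup_of w = [set` [fset x in gaps_list w]%fset].
  by apply/seteqP; split=> n /=; rewrite inE -mem_gaps_list.
rewrite set_fsetK -cardfE card_fseq undup_id //; exact: uniq_gaps_list.
Qed.

Lemma semigroup_of_kunz w : kunz w -> numerical_semigroup (semigroup_of w).
Proof.
move=> /kunzP[pw k1 k2]; split; last exact: finite_gaps.
  by rewrite semigroup_ofE mod0n.
move=> x y; rewrite !semigroup_ofE; set m := (size w).+1 => hx hy.
have xm := ltn_pmod x (ltn0Sn (size w)).
have ym := ltn_pmod y (ltn0Sn (size w)).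
have -> : (x + y) %% m = if x %% m + y %% m < m then x %% m + y %% m
   else x %% m + y %% m - m.
  rewrite -modnDm; case: ltnP => h; first by rewrite modn_small.
  by rewrite -[in LHS](subnK h) modnDr modn_small //; lia.
rewrite divnD //; case: ltnP => h.
  by have := k1 _ _ h; rewrite -/m; lia.
by have := k2 _ _ xm ym h; rewrite -/m; lia.
Qed.

Lemma cofinite_bound (S : set nat) : finite_set (~` S) ->
  exists B, forall n, B <= n -> S n.
Proof.
move=> /finite_fsetP[X hX].
exists (\max_(i <- enum_fset X) i).+1 => n hn; apply: contrapT => Sn.
have nX : n \in enum_fset X by have : (~` S) n by []; rewrite hX.
have h : n <= \max_(i <- X) i by exact: (@leq_bigmax_seq _ _ xpredT id).
by have := leq_trans hn h; rewrite ltnn.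
Qed.

(** The letter at i is the least c with c m + i in S. The Kunz conditions express
    that the sum of the least elements of two residue classes lies in S. *)
Lemma semigroup_kunz S : numerical_semigroup S ->
  exists2 w, kunz w & S = semigroup_of w.
Proof.
move=> [S0 SD finS].
have [B HB] := cofinite_bound finS.
have ex : (S `\ 0) !=set0 by exists B.+1; split=> //=; apply: HB.
have [[Sm m0] mmin] := set_minP ex; set m := set_min _ in Sm m0 mmin.
have {}m0 : 0 < m by rewrite lt0n; apply/eqP.
have Sc c : S (c * m) by elim: c => // c IH; rewrite mulSn; exact: SD.
have Sup c n : S n -> S (c * m + n) by move=> Sn; exact: SD.
have exi i : exists c, `[< S (c * m + i) >].
  by exists B; apply/asboolP/HB; rewrite (leq_trans _ (leq_addr _ _)) // leq_pmulr.
pose f i := ex_minn (exi i).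
have fP n i : (f i <= n) <-> S (n * m + i).
  rewrite /f; case: ex_minnP => c /asboolP Sc' cmin; split=> h.
    by rewrite -(subnK h) mulnDl -addnA; exact: Sup.
  by apply: cmin; apply/asboolP.
pose w := mkseq (fun i => f i.+1) m.-1.
have sw : (size w).+1 = m by rewrite size_mkseq prednK.
have wE i : i < m -> coord w i = f i.
  case: i => [_|i im]; last by rewrite /coord /= nth_mkseq //; lia.
  by apply/esym/eqP; rewrite -leqn0; apply/fP.
have SE : S = semigroup_of w.
  have H n : S n <-> semigroup_of w n.
    rewrite semigroup_ofE sw wE ?ltn_pmod //; rewrite {1}(divn_eq n m).
    by rewrite fP.
  by apply/seteqP; split=> n /H.
exists w => //; apply/kunzP; rewrite sw; split.
- move=> i im; rewrite wE; last lia.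
  rewrite lt0n; apply/eqP => fi.
  have : S i by apply/(fP 0); rewrite fi.
  by move=> Si; have := mmin i; rewrite /= => /(_ (conj Si _)); lia.
- move=> i j ij; rewrite !wE; [|lia..]; apply/fP.
  have -> : (f i + f j) * m + (i + j) = (f i * m + i) + (f j * m + j) by lia.
  by apply: SD; apply/fP.
move=> i j im jm ij; rewrite !wE; [|lia..]; apply/fP.
have -> : (f i + f j).+1 * m + (i + j - m) = (f i * m + i) + (f j * m + j) by lia.
by apply: SD; apply/fP.
Qed.

Lemma set_min_eq (A : set nat) a : A a -> (forall k, A k -> a <= k) -> set_min A = a.
Proof.
move=> Aa mina; have [|h1 h2] := @set_minP A; first by exists a.
by apply/eqP; rewrite eqn_leq h2 // mina.
Qed.

Lemma multiplicity_semigroup_of w :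
  all (ltn 0) w -> multiplicity (semigroup_of w) = (size w).+1.
Proof.
move=> pw; apply: set_min_eq => [|k [+ k0]].
  by split=> //; rewrite semigroup_ofE modnn divnn.
rewrite semigroup_ofE => sk; rewrite leqNgt; apply/negP => km; move: sk.
rewrite modn_small // divn_small // leqNgt coord_gt0 //.
by move: k0 => /= /eqP; rewrite -lt0n => ->.
Qed.

Lemma semigroup_of_inj w w' : all (ltn 0) w -> all (ltn 0) w' ->
  semigroup_of w = semigroup_of w' -> w = w'.
Proof.
move=> pw pw' e.
have sz : size w = size w'.
  by have := congr1 multiplicity e; rewrite !multiplicity_semigroup_of // => -[].
apply: (@eq_from_nth _ 0) => // i iw.
have H c : (coord w i.+1 <= c) = (coord w' i.+1 <= c).
  have := congr1 (fun S => S (c * (size w).+1 + i.+1)) e.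
  rewrite /= !semigroup_ofE -sz !divnMDl // !modnMDl !modn_small ?divn_small ?addn0 //; try lia.
  by move=> E; apply/idP/idP; rewrite E.
by apply/eqP; rewrite eqn_leq -[nth 0 w i]/(coord w i.+1)
  -[nth 0 w' i]/(coord w' i.+1) H leqnn -H leqnn.
Qed.

Lemma conductor_le S c : numerical_semigroup S ->
  (conductor S <= c) <-> (forall n, S (c + n)).
Proof.
move=> [S0 SD finS]; rewrite /conductor.
have ex : [set c | forall n, S (c + n)] !=set0.
  have [B HB] := cofinite_bound finS.
  by exists B => n; apply: HB; rewrite leq_addr.
have [h1 h2] := set_minP ex; split=> h; last exact: h2.
by move=> n; rewrite -(subnK h) -addnA addnCA; exact: h1.
Qed.

(** The depth is at most c exactly when every number from c m on is in the
    semigroup, that is, when every residue class is complete from its c-th term. *)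
Lemma depth_semigroup_of w c :
  kunz w -> (depth (semigroup_of w) <= c%:Z)%R = all (fun a => a <= c) w.
Proof.
move=> kw; have /andP[pw _] := kw.
rewrite /depth multiplicity_semigroup_of // Num.Theory.ceil_le_int.
rewrite ler_pdivrMr ?ltr0n // -[(c%:Z)%:~R%R]/(c%:R)%R -natrM ler_nat.
apply/idP/idP => [/(conductor_le _ (semigroup_of_kunz kw)) h|/all_nthP h].
  apply/(all_nthP 0) => i iw; have := h i.+1; rewrite semigroup_ofE.
  by rewrite divnMDl // modnMDl modn_small ?divn_small ?addn0 //; lia.
apply/(conductor_le _ (semigroup_of_kunz kw)) => n; rewrite semigroup_ofE divnMDl // modnMDl.
have := ltn_pmod n (ltn0Sn (size w)); case: (n %% _) => // i im.
by rewrite (leq_trans (h 0 i _)) // leq_addr.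
Qed.

Lemma ncard_kunz (P : pred (seq nat)) (A : set (set nat)) g :
  (forall w, kunz w -> A (semigroup_of w) <-> P w) ->
  ncard (semigroups_of_genus g `&` A) = count (fun w => kunz w && P w) (compositions g).
Proof.
move=> AP; rewrite -size_filter.
pose X := [fset w in [seq w <- compositions g | kunz w && P w]]%fset.
have -> : semigroups_of_genus g `&` A = [set semigroup_of w | w in [set` X]].
  apply/seteqP; split=> [S [[nS gS] AS]|S].
    have [w kw E] := semigroup_kunz nS; exists w; last by [].
    have /andP[pw _] := kw.
    rewrite /= inE mem_filter kw mem_compositions pw -gS E genus_semigroup_of eqxx andbT.
    by rewrite /= andbT; apply/(AP _ kw); rewrite -E.
  move=> [w /=]; rewrite inE mem_filter mem_compositions => /andP[/andP[kw Pw]] /andP[pw /eqP sw] <-.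
  split; last by apply/AP.
  by split; [exact: semigroup_of_kunz|rewrite genus_semigroup_of].
rewrite /ncard -(set_fsetK X) fset_set_image ?set_fsetK //.
rewrite card_in_imfset /=; last first.
  move=> w w'; rewrite !inE !mem_filter !mem_compositions.
  by move=> /andP[_ /andP[pw _]] /andP[_ /andP[pw' _]]; exact: semigroup_of_inj.
by rewrite card_fseq undup_id // filter_uniq // uniq_compositions.
Qed.

Lemma n_count g : n_ g = count kunz (compositions g).
Proof.
rewrite /n_ -[semigroups_of_genus g]setIT (@ncard_kunz predT) //.
by apply: eq_count => w /=; rewrite andbT.
Qed.

Lemma t_count g :
  t_ g = count (fun w => kunz w && all (fun a => a <= 3) w) (compositions g).
Proof.
rewrite /t_; apply: ncard_kunz => w kw.
by rewrite /= (depth_semigroup_of 3 kw).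
Qed.

Definition ndeep (g : nat) : nat :=
  count (fun w => kunz w && ~~ all (fun a => a <= 3) w) (compositions g).

Lemma nhat_count g : nhat_ g = ((ndeep g)%:Z)%R.
Proof.
rewrite /nhat_ n_count t_count /ndeep -!size_filter.
have := count_predC (all (fun a => a <= 3)) [seq w <- compositions g | kunz w].
rewrite -!size_filter -!filter_predI => <-.
have -> : [seq w <- compositions g | predI (all (leq^~ 3)) kunz w]
   = [seq w <- compositions g | kunz w & all (leq^~ 3) w].
  by apply: eq_filter => w /=; rewrite andbC.
have -> : [seq w <- compositions g | predI (predC (all (leq^~ 3))) kunz w]
   = [seq w <- compositions g | kunz w & ~~ all (leq^~ 3) w].
  by apply: eq_filter => w /=; rewrite andbC.
by rewrite PoszD addrAC subrr add0r.
Qed.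

End KunzWords.

(** * Words of depth at most three and stressed words *)

Section DepthThree.
Local Open Scope nat_scope.

Lemma coord_rcons w a i :
  coord (rcons w a) i = if i == (size w).+1 then a else coord w i.
Proof.
rewrite /coord -rcons_cons nth_rcons /= ltnS.
have [iw|iw] := leqP i (size w); first by rewrite ltn_eqF.
by case: eqP => // _; rewrite nth_default.
Qed.

Lemma coord_le w c i : all (fun a => a <= c) w -> coord w i <= c.
Proof.
move=> /all_nthP h; case: i => // i; rewrite /coord /=.
by case: (ltnP i (size w)) => iw; [exact: h|rewrite nth_default].
Qed.

Definition word3 (w : seq nat) : bool :=
  kunz w && all (fun a => a <= 3) w.

(** The wrap-around conditions are void here: 3 <= 1 + 1 + 1. *)
Lemma word3P w :
  reflect [/\ all (fun a => 0 < a <= 3) w &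
    forall i j, i + j <= size w -> coord w (i + j) <= coord w i + coord w j]
  (word3 w).
Proof.
apply: (iffP andP) => [[kw w3]|[w03 k1]].
  have /andP[pw _] := kw; have [_ k1 _] := kunzP _ kw; split=> //.
  by rewrite all_predI; apply/andP.
move: w03; rewrite all_predI => /andP[pw w3]; split=> //.
apply/kunzP; split => // [i iw|i j im jm ij].
  by apply: coord_gt0 => //; lia.
have := coord_le (i + j - (size w).+1) w3.
have : 0 < coord w i by apply: coord_gt0 => //; lia.
have : 0 < coord w j by apply: coord_gt0 => //; lia.
lia.
Qed.

(** The new last letter a only meets conditions in which it is the larger side,
    and these are void unless a = 3. *)
Lemma word3_rcons w a : word3 (rcons w a) = [&& word3 w, 0 < a <= 3 &
  (a == 3) ==> all (fun i => 2 < coord w i + coord w ((size w).+1 - i))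
     (iota 1 (size w))].
Proof.
apply/word3P/and3P.
  rewrite all_rcons => -[/andP[a03 w03]]; rewrite size_rcons => k1; split=> //.
    apply/word3P; split=> // i j ij; have := k1 i j.
    rewrite !coord_rcons.
    do 3 (case: eqP => ?; first lia); apply; lia.
  apply/implyP => /eqP a3; apply/allP => i; rewrite mem_iota => iw.
  have := k1 i ((size w).+1 - i); rewrite subnKC ?coord_rcons ?eqxx; last lia.
  do 2 (case: eqP => ?; first lia); rewrite a3; apply; lia.
move=> [/word3P[w03 k1] a03 /implyP h]; split.
  by rewrite all_rcons a03.
move: (w03); rewrite all_predI => /andP[pw _].
move=> i j; rewrite size_rcons leq_eqVlt => /orP[/eqP ij|ij]; last first.
  by rewrite !coord_rcons; do 3 (case: eqP => ?; first lia); apply: k1; lia.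
rewrite ij !coord_rcons eqxx.
do 2 (case: eqP => ?; first lia).
have -> : j = (size w).+1 - i by lia.
have [/eqP a3|a3] := boolP (a == 3).
  by have /allP/(_ i) := h (introT eqP a3); rewrite mem_iota a3; apply; lia.
have := @coord_gt0 _ i pw.
have := @coord_gt0 _ ((size w).+1 - i) pw.
lia.
Qed.

Definition stressed (w : seq nat) : bool := word3 w && (last 0 w == 3).

Definition nstressed (g : nat) : nat := count stressed (compositions g).

Lemma count_last a g : 0 < a <= g ->
  count (fun w => word3 w && (last 0 w == a)) (compositions g) =
  count (fun w => word3 (rcons w a)) (compositions (g - a)).
Proof.
move=> ag; rewrite -!size_filter -[RHS](size_map (rcons^~ a)).
apply/perm_size/uniq_perm; first by rewrite filter_uniq ?uniq_compositions.
  rewrite map_inj_uniq ?filter_uniq ?uniq_compositions // => u v.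
  by move=> /rcons_inj[].
move=> w; rewrite mem_filter mem_compositions; apply/idP/mapP.
  case/lastP: w => [|w b] /=; first by move=> /andP[/andP[_ /eqP]]; lia.
  rewrite last_rcons => /andP[/andP[+ /eqP bE]]; rewrite bE => ww.
  rewrite all_rcons sumn_rcons => /andP[/andP[_ pw] /eqP sw].
  exists w => //; rewrite mem_filter ww mem_compositions pw /=; apply/eqP; lia.
move=> [v]; rewrite mem_filter mem_compositions => /andP[vv /andP[pv /eqP sv]] ->.
rewrite vv last_rcons eqxx all_rcons sumn_rcons pv sv /=; lia.
Qed.

Lemma t_word3 g : t_ g = count word3 (compositions g).
Proof. by rewrite t_count. Qed.

(** Removing the last letter, the words of sum g ending in 1 and in 2 are counted by
    t_(g-1) and t_(g-2). *)
Lemma s_stressed g : 3 <= g -> s_ g = ((nstressed g)%:Z)%R.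
Proof.
move=> g3; rewrite /s_ ltnNge g3 /= !t_word3.
have <- : count (fun w => word3 w && (last 0 w == 1)) (compositions g) =
    count word3 (compositions (g - 1)).
  rewrite count_last; last lia.
  by apply: eq_count => w; rewrite word3_rcons /= !andbT.
have <- : count (fun w => word3 w && (last 0 w == 2)) (compositions g) =
    count word3 (compositions (g - 2)).
  rewrite count_last; last lia.
  by apply: eq_count => w; rewrite word3_rcons /= !andbT.
have -> : count word3 (compositions g) =
  count (fun w => word3 w && (last 0 w == 1)) (compositions g) +
  count (fun w => word3 w && (last 0 w == 2)) (compositions g) + nstressed g; last by lia.
have: all (fun w => w != [::]) (compositions g).
  by apply/allP => -[|a w] //; rewrite mem_compositions /=; lia.
rewrite /nstressed; elim: (compositions g) => //= w s IH /andP[w0 /IH ->].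
suff -> : word3 w = word3 w && (last 0 w == 1) + (word3 w && (last 0 w == 2)) +
   stressed w :> nat by lia.
rewrite /stressed; case: (boolP (word3 w)) => //=; case/lastP: w w0 => // w a _.
by rewrite word3_rcons last_rcons => /and3P[_ + _]; case: a => [|[|[|[|]]]].
Qed.

Fixpoint words_over (A : seq nat) (k : nat) : seq (seq nat) :=
  if k is k'.+1 then [seq a :: w | a <- A, w <- words_over A k'] else [:: [::]].

Lemma mem_words_over A k w : (w \in words_over A k) = (size w == k) && all (mem A) w.
Proof.
elim: k w => [|k IH] w; first by case: w.
apply/allpairsP/idP => [[[a v] /= [aA vk ->]]|].
  by move: vk; rewrite IH /= eqSS aA => /andP[-> ->].
case: w => // a w; rewrite /= eqSS => /andP[sw /andP[aA wA]].
by exists (a, w); rewrite /= aA IH sw wA.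
Qed.

Lemma words_over_uniq A k : uniq A -> uniq (words_over A k).
Proof.
move=> uA; elim: k => //= k IH; apply: allpairs_uniq => // -[a v] [b w] _ _ /=.
by case=> -> ->.
Qed.

(** Two letters 1 can only occur at positions i, j > k, and then i + j exceeds the
    length 2k + 1; so no condition is ever violated. *)
Lemma half_stressed k u v : u \in words_over [:: 2; 3] k -> v \in words_over [:: 1; 2; 3] k ->
  stressed (u ++ rcons v 3).
Proof.
rewrite !mem_words_over => /andP[/eqP su /allP uA] /andP[/eqP sv /allP vA].
have at_uv i : 0 < i -> i <= k -> 2 <= coord (u ++ v) i <= 3.
  case: i => // i _ ik; rewrite /coord /= nth_cat su ik.
  have : nth 0 u i \in u by rewrite mem_nth ?su.
  by move=> /uA; rewrite !inE => /orP[]/eqP->.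
have at_v i : k < i -> i <= k + k -> 1 <= coord (u ++ v) i <= 3.
  move=> ki ik; have [j ij] : exists j, i = (k + j).+1 by exists (i - k.+1)%N; lia.
  rewrite ij /coord /= nth_cat su (ltnNge (k + j)) leq_addr /= addKn.
  have : nth 0 v j \in v by rewrite mem_nth ?sv //; move: (ik) ki; lia.
  by move=> /vA; rewrite !inE => /or3P[]/eqP->.
have szuv : size (u ++ v) = k + k by rewrite size_cat su sv.
have at_uv3 i : 0 < i <= k + k -> 1 <= coord (u ++ v) i <= 3.
  move=> i0; case: (leqP i k) => ik; last by apply: at_v; lia.
  by have := at_uv i; lia.
rewrite -rcons_cat /stressed last_rcons eqxx andbT word3_rcons /= szuv.
apply/andP; split.
  apply/word3P; split.
    apply/(all_nthP 0) => i; rewrite szuv => ik.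
    by have := at_uv3 i.+1; rewrite /coord /=; apply; lia.
  rewrite szuv => -[|i] [|j] ij; rewrite ?addn0 ?add0n ?leq_addr //.
  have /andP[i1 _] : 1 <= coord (u ++ v) i.+1 <= 3 by apply: at_uv3; lia.
  have /andP[j1 _] : 1 <= coord (u ++ v) j.+1 <= 3 by apply: at_uv3; lia.
  have /andP[_ s3] : 1 <= coord (u ++ v) (i.+1 + j.+1) <= 3 by apply: at_uv3; lia.
  have [ik|ik] := leqP i.+1 k.
    by apply: leq_trans s3 _; have /andP[i2 _] := at_uv i.+1 isT ik; exact: leq_add i2 j1.
  have [jk|jk] := leqP j.+1 k.
    by apply: leq_trans s3 _; have /andP[j2 _] := at_uv j.+1 isT jk; exact: leq_add i1 j2.
  lia.
apply/allP => i; rewrite mem_iota => ik.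
have /andP[i1 _] : 1 <= coord (u ++ v) i <= 3 by apply: at_uv3; lia.
have /andP[j1 _] : 1 <= coord (u ++ v) ((k + k).+1 - i) <= 3 by apply: at_uv3; lia.
have [ik'|ik'] := leqP i k.
  have /andP[i2 _] : 2 <= coord (u ++ v) i <= 3 by apply: at_uv; lia.
  exact: leq_add i2 j1.
have /andP[j2 _] : 2 <= coord (u ++ v) ((k + k).+1 - i) <= 3 by apply: at_uv; lia.
exact: leq_add i1 j2.
Qed.

(** The letter 4 at position 1 is only constrained by the wrap-around condition for
    i + j = m + 1, where m = |u| + 2: the letters at i and j are not both 1. In
    a u b 3 this is the condition for the final 3, which sits at position m + 1.
    All other conditions that do not involve position 1 are inherited. *)
Lemma stressed_depth4 a b u : stressed (a :: u ++ [:: b; 3]) ->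
  kunz (4 :: u) && ~~ all (fun x => x <= 3) (4 :: u).
Proof.
move=> /andP[/word3P[w03 k1] _].
rewrite andbT; set w := a :: _ in w03 k1.
have sw : size w = (size u).+3 by rewrite /= size_cat addn2.
have atw i : 0 < i <= size u -> coord (4 :: u) i.+1 = coord w i.+1.
  by rewrite /coord /= ; case: i => // i /= iu; rewrite nth_cat iu.
have pw : all (ltn 0) w by move: w03; rewrite all_predI => /andP[].
have w3 : all (leq^~ 3) w by move: w03; rewrite all_predI => /andP[].
have at3 i : 1 < i <= (size u).+1 -> 1 <= coord (4 :: u) i <= 3.
  case: i => // i iu; rewrite atw; last lia.
  by rewrite coord_le // andbT; apply: coord_gt0 => //; lia.
have at1 : coord (4 :: u) 1 = 4 by [].
apply/kunzP; rewrite [size (_ :: _)]/=; split.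
- move=> i iu; have [->|i1] := eqVneq i 1; first by rewrite at1.
  by have := at3 i; lia.
- move=> i j ij.
  have [->|i0] := posnP i; first by [].
  have [->|j0] := posnP j; first by rewrite addn0 leq_addr.
  have := at3 (i + j).
  have [X1|i1] := eqVneq i 1; first by move: (at1); rewrite -X1; lia.
  have [X1|j1] := eqVneq j 1; first by move: (at1); rewrite -X1; lia.
  move=> _; have := k1 i j; rewrite sw.
  case: i i0 i1 ij => // i _ i1; case: j j0 j1 => // j _ j1 ij.
  rewrite addSn !atw; [|lia..].
  apply; lia.
move=> i j im jm ij.
have [E|ne] := eqVneq (i + j - (size u).+2) 1; last first.
  have := at3 (i + j - (size u).+2); have [E0|ne0] := posnP (i + j - (size u).+2).
    by rewrite E0.
  have := at3 i; have := at3 j.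
  have [X1|i1] := eqVneq i 1; first by move: (at1); rewrite -X1; lia.
  have [X1|j1] := eqVneq j 1; first by move: (at1); rewrite -X1; lia.
  lia.
rewrite E at1.
have [X1|i1] := eqVneq i 1; first by move: (at1); rewrite -X1; lia.
have [X1|j1] := eqVneq j 1; first by move: (at1); rewrite -X1; lia.
have := k1 i j; rewrite sw.
have -> : i + j = (size u).+3 by lia.
have -> : coord w (size u).+3 = 3.
  by rewrite /coord /= nth_cat ltnNge leqnSn /= subSnn.
case: i i1 im ij E => [|i] i1 im ij E; first lia.
case: j j1 jm ij E => [|j] j1 jm ij E; first lia.
by rewrite !atw; [move=> /(_ (leqnn _)); lia|lia..].
Qed.

(** From 4 u one recovers a u b 3 once a and b are known, and the genus drops by
    a + b + 3 - 4. *)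
Lemma nstressed_le g : 10 <= g ->
  nstressed g <= \sum_(a <- iota 1 3) \sum_(b <- iota 1 3) ndeep (g + 1 - a - b).
Proof.
move=> g10; pose X := [seq w <- compositions g | stressed w].
have wP w : w \in X -> exists a b u,
    [/\ w = a :: u ++ [:: b; 3], 0 < a <= 3 & 0 < b <= 3].
  rewrite mem_filter => /andP[/andP[/word3P[w03 _] l3]].
  rewrite mem_compositions => /andP[_ /eqP sw].
  case/lastP: w w03 l3 sw => [|w c w03] //; rewrite last_rcons => /eqP c3; subst c; move: w03.
  case/lastP: w => [|w b]; first by move=> _ /=; lia.
  case: w => [|a u]; first by rewrite /= !andbT => ?; lia.
  rewrite all_rcons rcons_cons /= all_rcons => /and3P[a3 b3 _] _.
  by exists a, b, u; rewrite a3 b3 -!cats1 -catA.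
rewrite /nstressed -size_filter -/X.
pose Y a b := [seq a :: behead v ++ [:: b; 3] | v <- [seq v <- compositions (g + 1 - a - b) |
   kunz v && ~~ all (fun x => x <= 3) v]].
have sub : {subset X <= flatten [seq Y a b | a <- iota 1 3, b <- iota 1 3]}.
  move=> w wX; have [a [b [u [E a3 b3]]]] := wP w wX.
  apply/flattenP; exists (Y a b).
    by apply/allpairsP; exists (a, b); rewrite !mem_iota.
  apply/mapP; exists (4 :: u); last by rewrite E.
  move: wX; rewrite !mem_filter E mem_compositions => /andP[sw /andP[pw /eqP s]].
  rewrite (stressed_depth4 sw) mem_compositions /=.
  move: pw s; rewrite /= all_cat sumn_cat /= => /and3P[_ -> _] s; apply/eqP; lia.
have uX : uniq X by rewrite filter_uniq ?uniq_compositions.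
apply: leq_trans (uniq_leq_size uX sub) _.
rewrite size_flatten /shape sumnE big_map /allpairs big_allpairs_dep.
by apply: leq_sum => a _; apply: leq_sum => b _; rewrite size_map size_filter.
Qed.

End DepthThree.

(** * Exponential growth rates, and the first two inequalities *)

Section LowerBounds.
Local Open Scope ring_scope.

Section growth.
Variable R : realType.
Implicit Types (x c z : R) (v : nat -> nat).

Lemma bernoulli_ineq z n : 1 <= z -> 1 + n%:R * (z - 1) <= z ^+ n.
Proof.
move=> z1; elim: n => [|n IH]; first by rewrite expr0; lra.
rewrite exprS -natr1; have n0 : 0 <= n%:R :> R by rewrite ler0n.
apply: le_trans (_ : z * (1 + n%:R * (z - 1)) <= _); last first.
  by rewrite ler_pM2l //; lra.
have h2 : 0 <= n%:R * (z - 1) ^+ 2 by rewrite mulr_ge0 ?exprn_ge0 //; lra.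
have h3 : z * (1 + n%:R * (z - 1)) =
  1 + (n%:R + 1) * (z - 1) + n%:R * (z - 1) ^+ 2 by ring.
rewrite h3; lra.
Qed.

Lemma expr_large z c : 1 < z -> exists N, forall n, (N <= n)%N -> c <= z ^+ n.
Proof.
move=> z1; have z10 : 0 < z - 1 by lra.
exists (Num.truncn (`|c| / (z - 1))).+1 => n Nn.
apply: le_trans (bernoulli_ineq n (ltW z1)).
have : `|c| / (z - 1) < n%:R.
  by apply: lt_le_trans (truncnS_gt _) _; rewrite ler_nat.
rewrite ltr_pdivrMr //; have := ler_norm c; lra.
Qed.

Lemma natr_le_expr z : 1 < z -> exists2 C : R, 1 <= C & forall n, n.+1%:R <= C * z ^+ n.
Proof.
move=> z1; have z10 : 0 < z - 1 by lra.
exists (1 + (z - 1)^-1) => [|n].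
  by rewrite lerDl invr_ge0 ltW.
apply: le_trans (_ : (1 + (z - 1)^-1) * (1 + n%:R * (z - 1)) <= _).
  rewrite -natr1 mulrDr mulr1 mulrA (mulrDl 1) mul1r mulrDl.
  rewrite [(z - 1)^-1 * n%:R]mulrC -mulrA mulVf ?lt0r_neq0 // mulr1.
  have : 0 <= n%:R * (z - 1) by rewrite mulr_ge0 ?ler0n // ltW.
  have : 0 < (z - 1)^-1 by rewrite invr_gt0.
  lra.
rewrite ler_pM2l ?bernoulli_ineq 1?ltW //.
by rewrite ltr_wpDr // invr_ge0 ltW.
Qed.

(** The next two facts translate statements about the limsup of g-th roots into
    eventual exponential bounds. *)
Lemma limsup_root_le v c N : 0 <= c ->
  (forall g, (N <= g)%N -> (v g)%:R <= c ^+ g) ->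
  (limsup_root R (fun g => (v g)%:Z) <= c%:E)%E.
Proof.
move=> c0 vc; apply: (@le_trans _ _ (ereal_sup
  ((fun g => ((((v g)%:Z)%:~R : R) `^ (g%:R^-1))%:E) @` [set g | (N.+1 <= g)%N])%classic)).
  apply: ereal_inf_lbound; exists [set g | (N.+1 <= g)%N]%classic => //.
  exact: nbhs_infty_ge.
apply: ge_ereal_sup => _ [g /= Ng <-]; rewrite lee_fin.
have g0 : (g%:R : R) != 0 by rewrite pnatr_eq0; lia.
apply: le_trans (_ : (c ^+ g) `^ (g%:R^-1) <= _).
  apply: ge0_ler_powR; rewrite ?invr_ge0 ?ler0n ?nnegrE ?exprn_ge0 //.
  by apply: vc; lia.
by rewrite -powR_mulrn // -powRrM divff // powRr1.
Qed.

Lemma limsup_root_lt v c : 0 <= c ->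
  (limsup_root R (fun g => (v g)%:Z) < c%:E)%E ->
  exists N, forall g, (N <= g)%N -> (v g)%:R <= c ^+ g.
Proof.
move=> c0 /ereal_inf_lt[_ [V [N _ NV] <-]] h.
exists N.+1 => g Ng; have g0 : (g%:R : R) != 0 by rewrite pnatr_eq0; lia.
have Vg : V g by apply: NV => /=; lia.
have : (((((v g)%:Z)%:~R : R) `^ (g%:R^-1))%:E <= c%:E)%E.
  apply: le_trans (ltW h); apply: ereal_sup_ubound; by exists g.
rewrite lee_fin => le1.
have : ((v g)%:R `^ g%:R^-1) `^ g%:R <= c `^ g%:R :> R.
  by apply: ge0_ler_powR; rewrite ?nnegrE ?ler0n ?powR_ge0.
by rewrite -powRrM mulVf // powRr1 ?ler0n // powR_mulrn.
Qed.

End growth.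

Section lower.
Variable R : realType.

(** Two thresholds are needed because each comparison loses a factor of
    subexponential size. *)
Lemma ereal_between (a b : \bar R) r : (a < b)%E -> (r%:E < b)%E ->
  exists c c' : R, [/\ r <= c, c < c', (a < c%:E)%E & (c'%:E < b)%E].
Proof.
case: a => [a| |]; case: b => [b| |]; rewrite ?lte_fin //= => ab rb.
- exists ((Num.max a r) + (b - Num.max a r) / 3), ((Num.max a r) + (b - Num.max a r) / 2).
  rewrite !lte_fin; set M := Num.max a r.
  have aM : a <= M by rewrite le_max lexx.
  have rM : r <= M by rewrite le_max lexx orbT.
  have Mb : M < b by rewrite gt_max ab rb.
  by split; lra.
- exists (Num.max a r + 1), (Num.max a r + 2); rewrite !lte_fin ltry.
  set M := Num.max a r.
  have aM : a <= M by rewrite le_max lexx.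
  have rM : r <= M by rewrite le_max lexx orbT.
  by split=> //; lra.
- by exists r, ((r + b) / 2); rewrite ltNyr !lte_fin; split=> //; lra.
- by exists r, (r + 1); rewrite ltNyr ltry; split=> //; lra.
Qed.

(** s_g as a natural number for every g, to which the growth criteria apply. *)
Definition s_nat (g : nat) : nat := if (g < 3)%N then 0%N else nstressed g.

Lemma s_natE : s_ = fun g => (s_nat g)%:Z.
Proof.
apply/funext => g; rewrite /s_nat; case: ltnP => g3; last exact: s_stressed.
by rewrite /s_ g3.
Qed.

Lemma nhat_ndeep : nhat_ = fun g => (ndeep g)%:Z.
Proof. by apply/funext => g; exact: nhat_count. Qed.

Lemma sum_words_over (A : seq nat) k (x : R) :
  \sum_(w <- words_over A k) x ^+ sumn w = (\sum_(a <- A) x ^+ a) ^+ k.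
Proof.
elim: k => [|k IH]; first by rewrite big_seq1.
rewrite /= big_allpairs_dep exprS -IH mulr_suml; apply: eq_bigr => a _.
by rewrite mulr_sumr; apply: eq_bigr => w _; rewrite /= exprD.
Qed.

Lemma sum_words_le (W : seq (seq nat)) (P : pred (seq nat)) lo hi (x : R) :
  0 <= x -> uniq W ->
  {in W, forall w, [/\ P w, all (ltn 0%N) w & (lo <= sumn w < hi)%N]} ->
  \sum_(w <- W) x ^+ sumn w <=
  \sum_(lo <= g < hi) (count P (compositions g))%:R * x ^+ g.
Proof.
move=> x0 uW WP.
rewrite [leLHS](_ : _ = \sum_(lo <= g < hi)
   (count (fun w => sumn w == g) W)%:R * x ^+ g).
  apply: ler_sum => g _; apply: ler_wpM2r; first exact: exprn_ge0.
  rewrite ler_nat -!size_filter; apply: uniq_leq_size; first exact: filter_uniq.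
  move=> w; rewrite !mem_filter mem_compositions => /andP[-> /WP[Pw pw _]].
  by rewrite Pw pw.
have H g : (count (fun w => sumn w == g) W)%:R * x ^+ g =
   \sum_(w <- W) (sumn w == g)%:R * x ^+ sumn w.
  rewrite -sum1_count natr_sum mulr_suml big_mkcond; apply: eq_bigr => w _.
  by case: eqP => [->|]; rewrite ?mul0r.
under [RHS]eq_bigr do rewrite H; rewrite exchange_big /=.
apply: eq_big_seq => w /WP[_ _ wlh].
rewrite (bigD1_seq (sumn w)) ?mem_index_iota ?iota_uniq //= eqxx mul1r.
by rewrite big1 ?addr0 // => g /negPf; rewrite eq_sym => ->; rewrite mul0r.
Qed.

Definition half_words k : seq (seq nat) :=
  [seq u ++ rcons v 3 | u <- words_over [:: 2; 3] k, v <- words_over [:: 1; 2; 3] k].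

Lemma sum_half_words k (x : R) :
  \sum_(w <- half_words k) x ^+ sumn w =
  x ^+ 3 * (x ^+ 3 * (x + 1) * (x ^+ 2 + x + 1)) ^+ k.
Proof.
rewrite /half_words big_allpairs_dep.
under eq_bigr do under eq_bigr do rewrite sumn_cat sumn_rcons 2!exprD.
under eq_bigr do rewrite -mulr_sumr -mulr_suml sum_words_over.
rewrite -mulr_suml sum_words_over !big_cons !big_nil mulrA -exprMn mulrC.
by congr (_ * _ ^+ _); ring.
Qed.

Lemma sumn_words_over A k w lo hi : w \in words_over A k -> {in A, forall a, (lo <= a <= hi)%N} ->
  (lo * k <= sumn w <= hi * k)%N.
Proof.
move=> + hA; elim: k w => [|k IH] w; first by rewrite inE => /eqP->; rewrite !muln0.
case/allpairsP => -[a v] /= [aA vk ->] /=.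
by have := IH _ vk; have := hA _ aA; rewrite !mulnS; lia.
Qed.

Lemma half_words_spec k w : w \in half_words k ->
  [/\ stressed w, all (ltn 0%N) w & (3 * k + 3 <= sumn w < 6 * k + 4)%N].
Proof.
case/allpairsP => -[u v] /= [uk vk ->]; have h := half_stressed uk vk; split=> //.
  by have /andP[/andP[/andP[]]] := h.
have h1 : (1 * k <= sumn v <= 3 * k)%N.
  by apply: (sumn_words_over vk) => a; rewrite !inE => /or3P[]/eqP->.
have h2 : (2 * k <= sumn u <= 3 * k)%N.
  by apply: (sumn_words_over uk) => a; rewrite !inE => /orP[]/eqP->.
rewrite sumn_cat sumn_rcons; lia.
Qed.

Lemma half_words_uniq k : uniq (half_words k).
Proof.
apply: allpairs_uniq => [||[u v] [u' v']]; try exact: words_over_uniq.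
move=> /allpairsP[[u1 v1] /= [+ _ [-> _]]] /allpairsP[[u2 v2] /= [+ _ [-> _]]].
rewrite !mem_words_over => /andP[/eqP s1 _] /andP[/eqP s2 _] /eqP.
by rewrite eqseq_cat ?s1 ?s2 // => /andP[/eqP-> /eqP/rcons_inj[->]].
Qed.

Lemma r151_spec : let x : R := (r151 R)^-1 in
  0 < x /\ x ^+ 3 * (x + 1) * (x ^+ 2 + x + 1) = 1.
Proof.
move=> x; have [x0 /rootP + _] := r151P R; rewrite horner_poly151 => h.
by split=> //; apply/eqP; rewrite -subr_eq0; apply/eqP.
Qed.

Lemma r151_gt1 : 1 < r151 R.
Proof.
have [x0 h] := r151_spec; rewrite -[r151 R]invrK; set x := _^-1 in x0 h *.
rewrite invf_gt1 // ltNge; apply/negP => x1.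
have x2 : 1 <= x ^+ 2 by rewrite exprn_ege1.
have x3 : 1 <= x ^+ 3 by rewrite exprn_ege1.
suff : 1 * 2 * 3 <= x ^+ 3 * (x + 1) * (x ^+ 2 + x + 1) by rewrite h; lra.
by apply: ler_pM; [lra|lra|apply: ler_pM; lra|lra].
Qed.

(** If s_g <= c^g eventually with c < r151, then the words of parameter k have
    weight at most (3k + 1) (c x)^(3k) at x = 1/r151, which tends to 0, although
    their weight is x^3. *)
Lemma r151_le : ((r151 R)%:E <= limsup_root R s_)%E.
Proof.
rewrite leNgt; apply/negP; rewrite s_natE => h.
have r0 : (0%:E < (r151 R)%:E)%E by rewrite lte_fin; have := r151_gt1; lra.
have [c [c' [c0 cc' hc]]] := ereal_between h r0.
rewrite lte_fin => c'r; have [N HN] := limsup_root_lt c0 hc.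
have [x0 px] := r151_spec; set x := _^-1 in x0 px.
have cx1 : c' * x < 1 by rewrite /x ltr_pdivrMr ?mul1r //; have := r151_gt1; lra.
have c'x0 : 0 < c' * x by rewrite mulr_gt0 //; lra.
pose z := (c' * x)^-1; have z1 : 1 < z by rewrite invf_gt1.
have H k : (N <= k)%N -> (1 <= k)%N -> x ^+ 3 <= (3 * k + 1)%:R * (c' * x) ^+ (3 * k).
  move=> Nk k1; have := sum_half_words k x; rewrite px expr1n mulr1 => <-.
  apply: le_trans (sum_words_le (ltW x0) (half_words_uniq k)
     (@half_words_spec k)) _.
  apply: le_trans (_ : \sum_(3 * k + 3 <= g < 6 * k + 4) (c' * x) ^+ (3 * k) <= _).
    rewrite big_nat [leRHS]big_nat; apply: ler_sum => g /andP[g1 g2].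
    have := HN g; rewrite /s_nat ltnNge (_ : (3 <= g)%N) /=; last by clear -g1; lia.
    rewrite -/(nstressed g) => hg.
    apply: le_trans (_ : (c' * x) ^+ g <= _).
      rewrite exprMn ler_pM2r ?exprn_gt0 //.
      apply: le_trans (hg _) _; first by clear -Nk g1; lia.
      by apply: lerXn2r; rewrite ?nnegrE; lra.
    apply: ler_wiXn2l; [lra|lra|clear -g1; lia].
  have -> : (6 * k + 4)%N = ((3 * k + 3) + (3 * k + 1))%N by clear; lia.
  by rewrite sumr_const_nat addKn mulr_natl.
have Hz k : (3 * k + 1)%:R * (c' * x) ^+ (3 * k) * z ^+ (3 * k) = (3 * k + 1)%:R.
  by rewrite -mulrA -exprMn divff ?expr1n ?mulr1 // lt0r_neq0.
(* y lies strictly between 1 and z: y^n beats the factor 3k + 1, z / y is left over. *)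
pose y := 1 + (z - 1) / 2.
have y1 : 1 < y by rewrite /y; lra.
have [C' C'1 hC'] := natr_le_expr y1.
have yz : 1 < z / y by rewrite ltr_pdivlMr /y; lra.
have [M hM] := expr_large ((C' + 1) / x ^+ 3) yz.
have [k [Nk k1 Mk]] : exists k, [/\ (N <= k)%N, (1 <= k)%N & (M <= 3 * k)%N].
  by exists (N + M + 1)%N; clear; split; lia.
have H1 := H k Nk k1.
have x3 : 0 < x ^+ 3 by rewrite exprn_gt0.
have h1 : (C' + 1) / x ^+ 3 <= (z / y) ^+ (3 * k) by exact: hM.
have h2 := hC' (3 * k)%N; rewrite -addn1 in h2.
have zy : 0 < z ^+ (3 * k) by rewrite exprn_gt0 //; lra.
have yp : 0 < y ^+ (3 * k) by rewrite exprn_gt0 //; lra.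
move: h1; rewrite expr_div_n ler_pdivlMr // mulrAC ler_pdivrMr // => h1.
have := ler_wpM2r (ltW zy) H1; rewrite Hz => h3.
suff : C' * y ^+ (3 * k) < (C' + 1) * y ^+ (3 * k) by move: h1 h2 h3; rewrite (mulrC (z ^+ _)); lra.
rewrite ltr_pM2r //; lra.
Qed.

(** A bound ndeep(g) <= c^g with c >= 1 gives at most 9 c^g stressed words, which is
    below c'^g for every c' > c. The case c < 1 is excluded since r151 > 1. *)
Lemma s_le_nhat : (limsup_root R s_ <= limsup_root R nhat_)%E.
Proof.
rewrite leNgt; apply/negP => h.
have h1 : (1%:E < limsup_root R s_)%E.
  by apply: lt_le_trans r151_le; rewrite lte_fin r151_gt1.
have [c [c' [c1 cc' hc hc']]] := ereal_between h h1.
move: hc' hc; rewrite s_natE nhat_ndeep => hc'.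
have c0 : 0 <= c by lra.
move=> /(limsup_root_lt c0)[N HN].
have z1 : 1 < c' / c by rewrite ltr_pdivlMr; lra.
have [M hM] := expr_large 9 z1.
suff : (limsup_root R (fun g => (s_nat g)%:Z) <= c'%:E)%E by rewrite leNgt hc'.
apply: (@limsup_root_le _ _ _ (N + M + 10)); first lra.
move=> g Ng; rewrite /s_nat ltnNge (_ : (3 <= g)%N) /=; last lia.
have h9 : (nstressed g)%:R <= (9%:R * c ^+ g : R).
  apply: le_trans (_ : (\sum_(a <- iota 1 3) \sum_(b <- iota 1 3)
     ndeep (g + 1 - a - b))%:R <= _).
    by rewrite ler_nat; apply: nstressed_le; lia.
  rewrite natr_sum (_ : 9%:R * _ = \sum_(a <- iota 1 3) (3%:R * c ^+ g)); last first.
    by rewrite !big_cons big_nil; ring.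
  rewrite big_seq [leRHS]big_seq; apply: ler_sum => a; rewrite mem_iota => a3.
  rewrite natr_sum (_ : 3%:R * _ = \sum_(b <- iota 1 3) (c ^+ g)); last first.
    by rewrite !big_cons big_nil; ring.
  rewrite big_seq [leRHS]big_seq; apply: ler_sum => b; rewrite mem_iota => b3.
  apply: le_trans (HN _ _) _; first lia.
  by rewrite ler_weXn2l //; lia.
have cg : 0 < c ^+ g by rewrite exprn_gt0 //; lra.
apply: (le_trans h9); rewrite -ler_pdivlMr // -expr_div_n; apply: hM; lia.
Qed.

End lower.

End LowerBounds.

(** * Covering the positions of small letters *)

Section Covers.
Local Open Scope nat_scope.

Section cover.
Import boot.finset.
Variables (m K D psi : nat).
Implicit Types (G F V : {set 'I_m}) (j : nat).

Definition sumset G F j : bool :=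
  (j < K) && [exists f in F, exists g in G, j == f + g].

(** Here G is a set of generators, positions carrying letters <= v, and F is a set of
    positions carrying letters <= u: on the sumset the letters are <= u + v. When
    there are fewer than D generators in total, G already lists all the positions
    of letters <= v, and nothing has to be gained from sumsets. *)
Definition capped G F j : bool := (D <= #|G|) && sumset G F j.

(** Letters <= v occur only at the first D such positions, which form G, or after
    them. *)
Definition cand_v G j : bool := (0 < j < K) &&
  ([exists g in G, j == g :> nat] || (D <= #|G|) && [forall g in G, g <= j]).

(** If j carries a letter <= u, then almost all its translates by G are already
    covered by the sumset, up to psi exceptions; see the choice of F below. *)
Definition cand_u G F j : bool := cand_v G j && ((#|G| < D) ||
  (#|[set g in G | (j + g < K) && ~~ sumset G F (j + g)]| <= psi)).

Lemma sumsetP G F j :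
  reflect (j < K /\ exists f g, [/\ f \in F, g \in G & j = f + g]) (sumset G F j).
Proof.
apply: (iffP andP) => [[jK /exists_inP[f fF /exists_inP[g gG /eqP]]]|].
  by split=> //; exists f, g.
move=> [jK [f [g [fF gG E]]]]; split=> //.
by apply/exists_inP; exists f => //; apply/exists_inP; exists g => //; apply/eqP.
Qed.

Lemma first_elements V d : exists G, [/\ G \subset V, #|G| <= d,
  (#|G| = d \/ G = V) & forall x g, x \in V -> x \notin G -> g \in G -> g <= x].
Proof.
elim: d => [|d [G [GV Gd Gdis Gmin]]].
  exists set0; rewrite sub0set cards0; split=> //; first by left.
  by move=> x g _ _; rewrite inE.
have [E|/set0Pn[x0 x0VG]] := eqVneq (V :\: G) set0.
  exists G; split=> //; first exact: leqW.
  by right; apply/eqP; rewrite eqEsubset GV -setD_eq0 E eqxx.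
have [x xVG xmin] := arg_minnP (fun i : 'I_m => i : nat) x0VG.
have /setDP[xV xG] : x \in V :\: G by [].
have Gd' : #|G| = d by case: Gdis => // E; rewrite E xV in xG.
exists (x |: G); split.
- by rewrite subUset sub1set xV.
- by rewrite cardsU1 xG Gd'.
- by left; rewrite cardsU1 xG Gd'.
move=> y g yV; rewrite !inE negb_or => /andP[yx yG] /orP[/eqP->|gG].
  by apply: xmin; apply/setDP.
exact: Gmin.
Qed.

(** G consists of the first D positions of letters <= v. F is a set of positions of
    letters <= u that maximizes |F + G| - psi |F|. Comparing with the empty set gives
    psi |F| <= m, so that F is small; comparing with F plus one element j shows that
    adding j contributes at most psi new sums. *)
Lemma cover_exists (w : nat -> nat) u v :
  u <= v -> K <= m ->
  (forall i j, i + j < K -> w (i + j) <= w i + w j) ->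
  exists G F, [/\ #|G| <= D, psi * #|F| <= m &
   forall j, 0 < j < K -> [/\ w j <= u -> cand_u G F j, w j <= v -> cand_v G j &
      capped G F j -> w j <= u + v]].
Proof.
move=> uv Km wD.
pose V := [set j : 'I_m | (0 < j < K) && (w j <= v)].
pose U := [set j : 'I_m | (0 < j < K) && (w j <= u)].
have [G [GV Gd Gdis Gmin]] := first_elements V D.
pose S F := [set j : 'I_m | sumset G F j].
have [F FU Fmax] := @arg_maxnP _ set0 (fun F : {set 'I_m} => F \subset U)
  (fun F : {set 'I_m} => #|S F| + psi * (m - #|F|)) (sub0set _).
have Fm : #|F| <= m by rewrite -[m in _ <= m]card_ord max_card.
have Sm : #|S F| <= m by rewrite -[m in _ <= m]card_ord max_card.
have mV j : 0 < j < K -> w j <= v -> cand_v G j.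
  move=> jK wj; rewrite /cand_v jK /=; have jm : j < m by lia.
  have jV : Ordinal jm \in V by rewrite inE jK.
  have [jG|jG] := boolP (Ordinal jm \in G).
    by apply/orP; left; apply/exists_inP; exists (Ordinal jm).
  apply/orP; right; case: Gdis => [->|E]; last by rewrite E jV in jG.
  by rewrite leqnn; apply/forall_inP => g gG; exact: (Gmin _ _ jV jG gG).
exists G, F; split=> //.
  have := Fmax set0 (sub0set _); rewrite cards0 subn0.
  rewrite mulnBr; have := leq_mul (leqnn psi) Fm; lia.
move=> j jK; split; [|exact: mV|].
  move=> wj; rewrite /cand_u mV ?(leq_trans wj) //=; apply/orP; right.
  have jm : j < m by lia.
  have jU : Ordinal jm \in U by rewrite inE jK.
  have [jF|jF] := boolP (Ordinal jm \in F).
    rewrite (_ : [set _ | _] = set0) ?cards0 //; apply/setP => g; rewrite !inE.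
    apply/negbTE/negP => /and3P[gG jgK /sumsetP]; apply; split=> //.
    by exists (Ordinal jm), g.
  have := Fmax (Ordinal jm |: F); rewrite subUset sub1set jU FU => /(_ isT).
  rewrite cardsU1 jF => FF.
  have Fm' : #|Ordinal jm |: F| <= m by rewrite -[m in _ <= m]card_ord max_card.
  rewrite cardsU1 jF add1n in Fm'.
  have {FF} FF : #|S (Ordinal jm |: F)| <= #|S F| + psi.
    have E1 : m - #|F| = (m - (true + #|F|)).+1 by rewrite add1n subnSK.
    move: FF; rewrite /geq /= E1 mulnS; set X := psi * _.
    by rewrite addnA leq_add2r.
  have SF : S F \subset S (Ordinal jm |: F).
    apply/fintype.subsetP => x; rewrite !inE => /sumsetP[xK [f [g [fF gG E]]]].
    by apply/sumsetP; split=> //; exists f, g; rewrite !inE fF orbT.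
  suff : #|[set g in G | (j + g < K) && ~~ sumset G F (j + g)]| <=
     #|S (Ordinal jm |: F) :\: S F|.
    by move=> /leq_trans; apply; rewrite cardsD (setIidPr SF); lia.
  pose h (g : 'I_m) : 'I_m := insubd (Ordinal jm) (j + g).
  have hE (g : 'I_m) : j + g < K -> h g = j + g :> nat.
    by move=> gK; rewrite /h val_insubd (leq_trans gK Km).
  rewrite -[leqLHS](@card_in_imset _ _ h); last first.
    move=> g g'; rewrite !inE => /and3P[_ gK _] /and3P[_ gK' _] /(congr1 val) /=.
    by rewrite !hE // => /addnI/val_inj.
  apply: subset_leq_card; apply/fintype.subsetP => _ /imsetP[g + ->].
  rewrite !inE => /and3P[gG gK gs].
  rewrite hE // gs /=; apply/sumsetP; split=> //.
  by exists (Ordinal jm), g; rewrite !inE eqxx.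
move=> /andP[_ /sumsetP[jK' [f [g [fF gG E]]]]].
move/fintype.subsetP: FU => /(_ _ fF); rewrite inE => /andP[_ wf].
move/fintype.subsetP: GV => /(_ _ gG); rewrite inE => /andP[_ wg].
by rewrite E; apply: leq_trans (wD _ _ _) (leq_add wf wg); rewrite -E.
Qed.

Definition cnt (P : pred nat) : nat := \sum_(0 <= j < K) P j.

Lemma cnt_ge B : \sum_(0 <= j < K) (B <= j : nat) <= K - B.
Proof.
elim: K => [|k IH]; first by rewrite big_nil.
by rewrite big_nat_recr //=; case: leqP => h; lia.
Qed.

Lemma cnt_ltB B : \sum_(0 <= j < K) (K <= j + B : nat) <= B.
Proof.
have H : forall k, \sum_(0 <= j < k) (K <= j + B : nat) <= k + B - K.
  elim=> [|k IH]; first by rewrite big_nil.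
  by rewrite big_nat_recr //=; case: leqP => h; lia.
by apply: leq_trans (H K) _; lia.
Qed.

Lemma cnt_shift (P : pred nat) g : (forall j, P j -> j < K) ->
  \sum_(0 <= j < K) (P (j + g) : nat) <= cnt P.
Proof.
move=> PK; case: (leqP g K) => gK; last first.
  by rewrite big1 // => j _; case E: (P (j + g)) => //; have := PK _ E; lia.
rewrite /cnt [leqRHS](@big_cat_nat _ _ _ g 0 K) //=.
apply: leq_trans _ (leq_addl _ _).
rewrite -{2}[g]add0n big_addn (@big_cat_nat _ _ _ (K - g) 0 K) //=; last exact: leq_subr.
rewrite -[leqRHS]addn0 leq_add2l big_nat big1 // => j jK.
by case E: (P (j + g)) => //; have := PK _ E; lia.
Qed.

(** Let B be the largest generator. Letters <= v avoid all but D positions below B,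
    so |V| <= K - B + D. A position of U below K - B has all its D translates inside
    the range, at least D - psi of them in N, whereas a point of N is hit at most D
    times; so |U| - B is at most |N| up to a proportion psi / D. Adding up, B
    cancels. *)
Lemma cover_card G F : 0 < D -> #|G| <= D ->
  D * (cnt (cand_u G F) + cnt (cand_v G)) <= D * cnt (capped G F) + D * (K + D.*2) + psi * K.
Proof.
move=> D0 GD.
have cG : \sum_(0 <= j < K) ([exists g in G, j == g :> nat] : nat) <= #|G|.
  apply: leq_trans (_ : \sum_(0 <= j < K) \sum_(g in G) (j == g :> nat) <= _).
    apply: leq_sum => j _; case: exists_inP => // -[g gG /eqP jg].
    by rewrite (bigD1 g) //= jg eqxx.
  rewrite exchange_big -sum1_card; apply: leq_sum => g _ /=.
  have [gK|gK] := ltnP g K; last first.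
    by rewrite big_nat big1 // => j /andP[_ jK]; case: eqP => //; lia.
  rewrite (bigD1_seq (g : nat)) ?mem_index_iota ?iota_uniq //= eqxx big1 ?addn0 //.
  by move=> j /negPf ->.
have QUV : cnt (cand_u G F) <= cnt (cand_v G).
  by apply: leq_sum => j _; rewrite /cand_u; case: (cand_v G j) => //=; exact: leq_b1.
have [GltD|DG] := ltnP #|G| D.
  have : cnt (cand_v G) <= #|G|.
    apply: leq_trans _ cG; apply: leq_sum => j _; rewrite /cand_v (leqNgt D) GltD /= orbF.
    by case: (0 < j < K).
  by nia.
have {GD DG} GD : #|G| = D by lia.
pose B := \max_(g in G) g.
have hV : cnt (cand_v G) <= D + (K - B).
  rewrite -{1}GD; apply: leq_trans _ (leq_add cG (cnt_ge B)).
  rewrite -big_split; apply: leq_sum => j _; rewrite /cand_v GD leqnn /=.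
  case: (0 < j < K) => //=; case: [exists g in G, _] => //=.
  case: forall_inP => //= h; suff -> : B <= j by [].
  by apply/bigmax_leqP.
have hU : cnt (cand_u G F) <= \sum_(0 <= j < K) (cand_u G F j && (j + B < K) : nat) + B.
  rewrite [leqRHS]addnC; apply: leq_trans _ (leq_add (cnt_ltB B) (leqnn _)).
  rewrite -big_split; apply: leq_sum => j _ /=; rewrite (leqNgt K).
  by case: (j + B < K); rewrite ?andbT ?andbF ?leq_b1.
have hS : D * \sum_(0 <= j < K) (cand_u G F j && (j + B < K) : nat) <=
    D * cnt (capped G F) + psi * K.
  have -> : cnt (capped G F) = cnt (sumset G F).
    by apply: eq_bigr => j _; rewrite /capped GD leqnn.
  apply: leq_trans (_ : \sum_(0 <= j < K)
    (\sum_(g in G) (sumset G F (j + g) : nat) + psi) <= _).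
    rewrite big_distrr /=; apply: leq_sum => j _.
    case: andP => [[/andP[_ +] jB]|]; last by rewrite muln0.
    rewrite GD ltnn /= muln1 => h; rewrite -{1}GD -sum1_card.
    apply: leq_trans (leq_add (leqnn _) h).
    rewrite -sum1_card [X in _ <= _ + X](eq_bigl (fun g => (g \in G) &&
       ~~ sumset G F (j + g))); last first.
      move=> g; rewrite inE; case gG: (g \in G) => //=.
      by rewrite (leq_ltn_trans _ jB) // leq_add2l; exact: (@leq_bigmax_cond _ _ (fun i : 'I_m => i : nat)).
    rewrite (bigID (fun g : 'I_m => sumset G F (j + g))) /=.
    by rewrite leq_add2r big_mkcondr /=; apply: leq_sum => g _; case: sumset.
  rewrite big_split /= sum_nat_const_nat subn0 [K * psi]mulnC leq_add2r.
  rewrite exchange_big /= -{1}GD -sum_nat_const; apply: leq_sum => g _.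
  by apply: cnt_shift => j /andP[].
have BK : B <= K \/ K < B by lia.
rewrite -mul2n; nia.
Qed.

End cover.

End Covers.

(** * Generating functions of words constrained on the orbits of an involution *)

Section MirrorPairs.
Local Open Scope ring_scope.

Section reflection.
Variables (R : realType) (m : nat) (sigma : 'I_m -> 'I_m).
Hypothesis sigmaK : involutive sigma.

(** Each orbit of the involution is represented by its smaller element. *)
Lemma prod_orbits (f : 'I_m -> R) :
  \prod_(j < m) f j = \prod_(j < m) (if (j < sigma j)%N then f j * f (sigma j)
                         else if j == sigma j then f j else 1).
Proof.
rewrite (bigID (fun j : 'I_m => (j < sigma j)%N)) /=.
rewrite [in RHS](bigID (fun j : 'I_m => (j < sigma j)%N)) /=.
rewrite [X in _ = X * _](eq_bigr (fun j => f j * f (sigma j))) ?big_split /=; last first.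
  by move=> j ->.
rewrite -mulrA; congr (_ * _).
rewrite (bigID (fun j : 'I_m => j == sigma j)) /= mulrC; congr (_ * _).
  rewrite (reindex_inj (inv_inj sigmaK)) /=; apply: eq_bigl => j.
  rewrite sigmaK -(inj_eq val_inj) /=.
  by case: ltngtP.
rewrite [RHS](bigID (fun j : 'I_m => j == sigma j)) /= [X in _ = _ * X]big1 ?mulr1.
  by apply: eq_bigr => j /andP[/negPf -> ->].
by move=> j /andP[/negPf -> /negPf ->].
Qed.

Lemma sumn_coord w : size w = m.-1 -> (0 < m)%N -> sumn w = (\sum_(j < m) coord w j)%N.
Proof.
case: m => // n sw _; rewrite big_ord_recl add0n sumnE (big_nth 0%N) sw big_mkord.
by apply: eq_bigr.
Qed.

(** Reading a word as the family of its pairs (w_j, w_(sigma j)), one for each orbit,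
    is injective, and the constraints only relate the two letters of a pair. The
    weighted count is then at most the product of the weights of the pairs. The
    constant M absorbs the orbits of size one. *)
Lemma reflection_bound B (L : seq (seq nat)) (x M : R) (h : 'I_m -> R)
    (ok : 'I_m -> nat -> nat -> bool) :
  0 <= x -> 1 <= M -> (0 < m)%N -> uniq L ->
  {in L, forall w, [/\ size w = m.-1, forall j, (coord w j <= B)%N &
     forall j : 'I_m, (j < sigma j)%N -> ok j (coord w j) (coord w (sigma j))]} ->
  (forall j, 0 < h j) ->
  (forall j : 'I_m, (j < sigma j)%N ->
     \sum_(a < B.+1) \sum_(b < B.+1 | ok j a b) x ^+ (a + b)%N <= h j * h (sigma j)) ->
  (forall j, j = sigma j -> \sum_(a < B.+1) x ^+ a <= M * h j) ->
  \sum_(w <- L) x ^+ sumn w <= M ^+ #|[pred j | j == sigma j]| * \prod_(j < m) h j.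
Proof.
move=> x0 M1 m0 uL Lok h0 hpair hfix.
pose V := ('I_B.+1 * 'I_B.+1)%type.
pose P (j : 'I_m) (p : V) := if (j < sigma j)%N then ok j p.1 p.2 else
  if j == sigma j then p.2 == ord0 else (p.1 == ord0) && (p.2 == ord0).
pose F (j : 'I_m) (p : V) : R := if (j < sigma j)%N then x ^+ (p.1 + p.2)%N else
  if j == sigma j then x ^+ p.1 else 1.
pose code (w : seq nat) : {ffun 'I_m -> V} := [ffun j : 'I_m =>
  if (j < sigma j)%N then (inord (coord w j), inord (coord w (sigma j))) else
  if j == sigma j then (inord (coord w j), ord0) else (ord0, ord0)].
have codeF w : w \in L -> x ^+ sumn w = \prod_(j < m) F j (code w j).
  move=> /Lok[sw wB _]; rewrite (sumn_coord sw m0) -prodrXr [LHS]prod_orbits.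
  apply: eq_bigr => j _; rewrite /F ffunE; case: ifP => _ /=.
    by rewrite !inordK ?ltnS ?wB // exprD.
  by case: ifP => _ //=; rewrite inordK ?ltnS ?wB.
have codeP w : w \in L -> code w \in family P.
  move=> /Lok[sw wB okw]; apply/familyP => j; suff : P j (code w j) by [].
  rewrite /P ffunE; case: (boolP (j < sigma j)%N) => [js|_] /=.
    by rewrite !inordK ?ltnS ?wB // okw.
  by case: (j == sigma j).
have code_inj : {in L &, injective code}.
  move=> w w' wL w'L /ffunP e; have [sw wB _] := Lok _ wL; have [sw' wB' _] := Lok _ w'L.
  have inordI (a b : nat) : (a <= B)%N -> (b <= B)%N ->
      inord a = inord b :> 'I_B.+1 -> a = b.
    by move=> aB bB /(congr1 val) /=; rewrite !inordK.
  have e' (j : 'I_m) : coord w j = coord w' j.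
    have := e j; have := e (sigma j); rewrite !ffunE sigmaK.
    have [js|js|js] := ltngtP (nat_of_ord j) (nat_of_ord (sigma j)).
    - by move=> _ [/inordI -> //].
    - by move=> [_ /inordI -> //].
    have {}js : j = sigma j by apply: val_inj.
    by rewrite -js eqxx => _ [/inordI ->].
  apply: (@eq_from_nth _ 0%N); rewrite ?sw ?sw' // => i im.
  have im' : (i.+1 < m)%N by move: im; case: (m) m0.
  exact: (e' (Ordinal im')).
have F0 j p : 0 <= F j p by rewrite /F; case: ifP => _; [|case: ifP => _]; rewrite ?exprn_ge0.
have -> : \sum_(w <- L) x ^+ sumn w = \sum_(c <- map code L) \prod_(j < m) F j (c j).
  by rewrite big_map; apply: eq_big_seq => w /codeF.
rewrite big_uniq ?map_inj_in_uniq //=.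
apply: le_trans (_ : \sum_(c in family P) \prod_(j < m) F j (c j) <= _).
  rewrite big_mkcond [leRHS]big_mkcond; apply: ler_sum => c _.
  case: ifP => [/mapP[w wL ->]|_]; first by rewrite codeP.
  by case: ifP => // _; apply: prodr_ge0.
rewrite -bigA_distr_big_dep.
apply: le_trans (_ : \prod_(j < m) (if (j < sigma j)%N then h j * h (sigma j) else
   if j == sigma j then M * h j else 1) <= _).
  apply: ler_prod => j _; rewrite sumr_ge0 => //=.
  have [js|js] := boolP (j < sigma j)%N.
    apply: le_trans (hpair j js); rewrite pair_big_dep /=.
    by rewrite le_eqVlt; apply/orP; left; apply/eqP/eq_big => p; rewrite /P /F js.
  have [js'|js'] := boolP (j == sigma j).
    apply: le_trans (hfix j (eqP js')).
    rewrite (eq_bigl (fun p : V => true && (p.2 == ord0))); last first.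
      by move=> p; rewrite /P (negPf js) js'.
    rewrite (eq_bigr (fun p : V => x ^+ p.1)); last first.
      by move=> p _; rewrite /F (negPf js) js'.
    rewrite -(pair_big_dep xpredT (fun _ b : 'I_B.+1 => b == ord0) (fun a _ : 'I_B.+1 => x ^+ a)) /=.
    by apply: ler_sum => a _; rewrite big_pred1_eq.
  rewrite (bigD1 (ord0, ord0)) /=; last by rewrite /P (negPf js) (negPf js').
  rewrite /F (negPf js) (negPf js') big1 ?addr0 // => p.
  rewrite /P (negPf js) (negPf js') => /andP[/andP[/eqP p1 /eqP p2]].
  by case: p p1 p2 => a b /= -> ->; rewrite eqxx.
rewrite (prod_orbits h) -(prodr_const) [X in _ <= X * _]big_mkcond -big_split /=.
apply: ler_prod => j _; rewrite inE.
case: ltngtP => [js|js|js].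
- rewrite (_ : (j == sigma j) = false) ?mul1r ?lexx ?andbT.
    by rewrite mulr_ge0 ?ltW.
  by apply/negbTE/eqP => E; rewrite -E ltnn in js.
- rewrite (_ : (j == sigma j) = false) ?mul1r ?lexx ?ler01 //.
  by apply/negbTE/eqP => E; rewrite -E ltnn in js.
have {}js : j = sigma j by apply: val_inj.
by rewrite -js eqxx !lexx andbT mulr_ge0 ?ltW //; lra.
Qed.

End reflection.

End MirrorPairs.

(** * Numerical bounds for one mirror pair *)

Section PairSums.
Local Open Scope ring_scope.

Section tables.
Variable R : realType.

(** The point at which generating functions are evaluated: a fraction slightly above
    1/r154 = 0.6454538... *)
Definition x1 : R := 71 / 110.
(** The bases of the two potentials. There is room in the choice of the first one. The
    second one is nearly forced: the pairs over {1, 2, 3} with sum >= 3 require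
    mu^2 >= 1.35487, and the pairs over {2, 3, 4} with sum >= 4 require
    mu^2 <= 1.35498. *)
Definition gam : R := 6 / 5.
Definition mu : R := 291 / 250.

Definition vals (lo hi : nat) : seq nat := iota lo (hi.+1 - lo).

Definition pair_sum (x : R) (s : nat) (A B : seq nat) : R :=
  \sum_(a <- A) \sum_(b <- B | (s <= a + b)%N) x ^+ (a + b)%N.

(** All potentials are quotients of this form, and products of potentials add up the
    exponents. *)
Definition weight (a b c d : nat) : R := mu ^+ a * gam ^+ b / (mu ^+ c * gam ^+ d).

Lemma mu_ge1 : 1 <= mu. Proof. rewrite /mu; lra. Qed.
Lemma gam_ge1 : 1 <= gam. Proof. rewrite /gam; lra. Qed.
Lemma mu_gam_le2 : mu * gam <= 2. Proof. rewrite /mu /gam; lra. Qed.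

Lemma mu_gt0 : 0 < mu. Proof. by apply: lt_le_trans mu_ge1. Qed.
Lemma gam_gt0 : 0 < gam. Proof. by apply: lt_le_trans gam_ge1. Qed.

Lemma weight_gt0 a b c d : 0 < weight a b c d.
Proof. by rewrite divr_gt0 // mulr_gt0 // exprn_gt0 // (mu_gt0, gam_gt0). Qed.

Lemma weightM a b c d a' b' c' d' :
  weight a b c d * weight a' b' c' d' = weight (a + a') (b + b') (c + c') (d + d').
Proof. by rewrite /weight !exprD mulf_div; congr (_ / _); ring. Qed.

Definition powN (k e : nat) : BinNums.N := BinNat.N.pow (BinNat.N.of_nat k) (BinNat.N.of_nat e).

(** x1^e scaled by 110^12, in binary arithmetic; pairs of letters up to 6 have sums
    at most 12. *)
Definition termN (e : nat) : BinNums.N := BinNat.N.mul (powN 71 e) (powN 110 (12 - e)).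

Definition pair_sumN (s : nat) (A B : seq nat) : BinNums.N :=
  foldr BinNat.N.add BinNums.N0
    [seq termN e | e <- [seq (a + b)%N | a <- A, b <- B] & (s <= e)%N].

Definition prodN (k1 k2 k3 k4 a b c d : nat) : BinNums.N :=
  BinNat.N.mul (BinNat.N.mul (powN k1 a) (powN k2 b))
               (BinNat.N.mul (powN k3 c) (powN k4 d)).

(** The bound of a pair sum by a potential, with denominators cleared. *)
Definition pair_sum_ok (s : nat) (A B : seq nat) (a b c d : nat) : bool :=
  BinNat.N.leb (BinNat.N.mul (pair_sumN s A B) (prodN 250 5 291 6 a b c d))
    (BinNat.N.mul (powN 110 12) (prodN 291 6 250 5 a b c d)).

Let rN (n : BinNums.N) : R := (BinNat.N.to_nat n)%:R.

Let rND m n : rN (BinNat.N.add m n) = rN m + rN n.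
Proof. by rewrite /rN Nnat.N2Nat.inj_add natrD. Qed.
Let rNM m n : rN (BinNat.N.mul m n) = rN m * rN n.
Proof. by rewrite /rN Nnat.N2Nat.inj_mul natrM. Qed.
Let rNX k e : rN (powN k e) = k%:R ^+ e.
Proof.
elim: e => [|e IH]; first by rewrite expr0.
rewrite /powN Nnat.Nat2N.inj_succ BinNat.N.pow_succ_r' rNM -/(powN k e) IH exprS.
by rewrite /rN Nnat.Nat2N.id.
Qed.
Let rN_le m n : BinNat.N.leb m n -> rN m <= rN n.
Proof.
by move=> /BinNat.N.leb_le /BinNat.N.sub_add <-; rewrite rND lerDr ler0n.
Qed.

Lemma pair_sum_check s A B a b c d : all (leq^~ 6%N) A -> all (leq^~ 6%N) B ->
  pair_sum_ok s A B a b c d -> pair_sum x1 s A B <= weight a b c d.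
Proof.
move=> A6 B6 /rN_le.
rewrite /prodN !rNM !rNX.
have -> : rN (pair_sumN s A B) = 110 ^+ 12 * pair_sum x1 s A B.
  rewrite /pair_sum /pair_sumN; transitivity (\sum_(e <- [seq (a + b)%N | a <- A, b <- B] | (s <= e)%N)
     110 ^+ 12 * x1 ^+ e : R).
    have : all (leq^~ 12%N) [seq (a + b)%N | a <- A, b <- B].
      apply/allP => _ /allpairsP[[i j] /= [/(allP A6) i6 /(allP B6) j6 ->]]; lia.
    elim: [seq _ | _ <- _, _ <- _]%N => [_|e l IH /= /andP[e12 /IH{}IH]].
      by rewrite big_nil.
    rewrite big_cons; case: ifP => // _ /=.
    rewrite rND IH /termN rNM !rNX; congr (_ + _).
    have -> : (110 : R) ^+ 12 = 110 ^+ e * 110 ^+ (12 - e) by rewrite -exprD subnKC.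
    have h : (110 : R) ^+ e != 0 by rewrite expf_neq0 //; apply: lt0r_neq0; lra.
    by rewrite /x1 expr_div_n [RHS]mulrAC [110 ^+ e * _]mulrC divfK.
  rewrite -mulr_sumr; congr (_ * _); rewrite big_mkcond big_allpairs_dep.
  by apply: eq_bigr => i _; rewrite [RHS]big_mkcond.
rewrite /weight /mu /gam !expr_div_n.
have := @exprn_gt0 R; move=> p.
have p110 : 0 < (110 : R) ^+ 12 by apply: p; lra.
have pa : 0 < (250 : R) ^+ a by apply: p; lra.
have pb : 0 < (5 : R) ^+ b by apply: p; lra.
have pc : 0 < (291 : R) ^+ c by apply: p; lra.
have pd : 0 < (6 : R) ^+ d by apply: p; lra.
have pc' : 0 < (250 : R) ^+ c by apply: p; lra.
have pd' : 0 < (5 : R) ^+ d by apply: p; lra.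
set P := pair_sum _ _ _ _ => h.
rewrite (_ : _ / _ = (291 ^+ a * 6 ^+ b * 250 ^+ c * 5 ^+ d) /
  (250 ^+ a * 5 ^+ b * 291 ^+ c * 6 ^+ d)); last first.
  by field; rewrite !lt0r_neq0.
rewrite ler_pdivlMr; last by rewrite !mulr_gt0.
by rewrite -(ler_pM2l p110) !mulrA; move: h; rewrite !mulrA.
Qed.

(** The smallest letter that may occur at a position, according to whether the position
    may carry a letter <= 1 and a letter <= 2. *)
Definition lowest (q1 q2 : bool) : nat := if q1 then 1 else if q2 then 2 else 3.

(** Potential of a position for (u, v) = (1, 2): gam to the power q1 + q2 - n - 1, where
    the booleans tell whether the position is in U, in V and in N. *)
Definition weight12 (q1 q2 n : bool) : R := weight 0 (q1 + q2) 0 n.+1.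

(** Potential of a position for (u, v) = (1, 1), where U and V are both replaced by U:
    mu to the power 2q - n - 1. *)
Definition weight11 (q n : bool) : R := weight (q + q) 0 n.+1 0.

Lemma pair_sum_le12 s q1 q2 n q1' q2' n' : (4 <= s <= 6)%N -> q1 ==> q2 -> q1' ==> q2' ->
  pair_sum x1 s (vals (lowest q1 q2) (if n then 3 else s))
          (vals (lowest q1' q2') (if n' then 3 else s)) <= weight12 q1 q2 n * weight12 q1' q2' n'.
Proof.
move=> s46; have : s \in iota 4 3 by rewrite mem_iota.
rewrite !inE /weight12 weightM => /or3P[]/eqP -> {s s46};
case: q1 => //; case: q2 => //; case: n => //;
case: q1' => //; case: q2' => //; case: n' => // _ _;
by apply: pair_sum_check => //; vm_compute.
Qed.

Lemma pair_sum_le11 q n q' n' :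
  pair_sum x1 3 (vals (if q then 1 else 2) (if n then 2 else 3))
          (vals (if q' then 1 else 2) (if n' then 2 else 3)) <= weight11 q n * weight11 q' n'.
Proof.
rewrite /weight11 weightM.
by case: q; case: n; case: q'; case: n'; apply: pair_sum_check => //; vm_compute.
Qed.

(** For q = 4 and a position before the maximum, the potential depends on five booleans,
    but the letters allowed form an interval from lo to hi. This is the smallest
    potential among the positions with given lo and hi. *)
Definition weight4 (lo hi : nat) : R := weight11 (lo == 1%N) (hi == 2%N) *
  weight12 (lo == 1%N) (lo <= 2)%N (hi <= 3)%N.

Lemma pair_sum_le4 lo hi lo' hi' : lo \in iota 1 3 -> hi \in iota 2 3 ->
  lo' \in iota 1 3 -> hi' \in iota 2 3 ->
  pair_sum x1 4 (vals lo hi) (vals lo' hi') <= weight4 lo hi * weight4 lo' hi'.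
Proof.
rewrite !inE /weight4 /weight11 /weight12 !weightM.
move=> /or3P[]/eqP -> /or3P[]/eqP -> /or3P[]/eqP -> /or3P[]/eqP ->;
by apply: pair_sum_check => //; vm_compute.
Qed.

Lemma weight4_le qa q1 q2 na n3 : q1 ==> q2 ->
  weight4 (lowest (qa && q1) q2) (if na then 2 else if n3 then 3 else 4)
  <= weight11 qa na * weight12 q1 q2 n3.
Proof.
rewrite /weight4 /weight11 /weight12 !weightM /weight /mu /gam.
by case: q1 => //; case: q2 => //; case: qa => //; case: na => //; case: n3 => //= _; lra.
Qed.

Lemma weight_ge (a b c d : nat) : (c <= 2)%N -> (d <= 2)%N -> 1 / 2 <= weight a b c d.
Proof.
move=> c2 d2.
have mu1 := mu_ge1; have gam1 := gam_ge1.
have mup := mu_gt0; have gamp := gam_gt0.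
have hc : mu ^+ c <= mu ^+ 2 by rewrite ler_weXn2l.
have hd : gam ^+ d <= gam ^+ 2 by rewrite ler_weXn2l.
have h1 : 1 <= mu ^+ a by apply: exprn_ege1.
have h2 : 1 <= gam ^+ b by apply: exprn_ege1.
have h3 := ler_pM ler01 ler01 h1 h2.
have h4 := ler_pM (exprn_ge0 _ (ltW mup)) (exprn_ge0 _ (ltW gamp)) hc hd.
have h5 : mu ^+ 2 * gam ^+ 2 <= 2 by rewrite /mu /gam; lra.
rewrite /weight ler_pdivlMr; last by rewrite mulr_gt0 ?exprn_gt0.
rewrite mul1r in h3; apply: le_trans h3.
by rewrite div1r mulrC ler_pdivrMr ?mul1r ?(le_trans h4 h5) //; lra.
Qed.

End tables.

End PairSums.

(** * Kunz words with a given last maximum *)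

Section PeakedWords.
Local Open Scope nat_scope.

(** The reflection attached to the Kunz conditions at position k: it exchanges j and
    k - j before k, and j and k + m - j after k. *)
Definition mirror (m k j : nat) : nat :=
  if j == 0 then 0 else if j < k then k - j else if j == k then k else k + m - j.

Definition mirror_ord (m k : nat) (j : 'I_m) : 'I_m := insubd j (mirror m k j).

Lemma mirror_ordE m k (j : 'I_m) : k < m -> mirror_ord k j = mirror m k j :> nat.
Proof.
move=> km; rewrite /mirror_ord val_insubd; suff -> : mirror m k j < m by [].
have := ltn_ord j; rewrite /mirror; case: eqP => ?; first lia.
by case: (ltngtP j k) => ?; lia.
Qed.

Lemma mirrorK m k j : j < m -> k < m -> mirror m k (mirror m k j) = j.
Proof.
move=> jm km; rewrite /mirror; have [->|j0] := eqVneq j 0; first by rewrite eqxx.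
case: (ltngtP j k) => jk.
- by rewrite ifF ?ifT; [lia|lia|apply/eqP; lia].
- do 3 (rewrite ifF; last by apply/negP => /= ; lia). lia.
- by rewrite -jk (negPf j0) ltnn eqxx.
Qed.

Lemma mirror_ordK m k : k < m -> involutive (@mirror_ord m k).
Proof. by move=> km j; apply: val_inj; rewrite /= !mirror_ordE // mirrorK. Qed.

(** Besides 0 and k, only the midpoints of the two reflected intervals are fixed. *)
Lemma card_mirror_fix m k : k < m -> #|[pred j : 'I_m | j == mirror_ord k j]| <= 4.
Proof.
move=> km; rewrite cardE -(size_map val).
apply: (@uniq_leq_size _ _ [:: 0; k; k./2; (k + m)./2]).
  by rewrite map_inj_uniq ?enum_uniq //; exact: val_inj.
move=> _ /mapP[j + ->]; rewrite mem_enum !inE -(inj_eq val_inj) /= mirror_ordE // /mirror.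
have := ltn_ord j; case: (eqVneq (j : nat) 0) => [-> //|j0 jm].
case: (ltngtP j k) => [jk /eqP E|jk /eqP E|->]; rewrite ?eqxx ?orbT //.
  by apply/or4P; apply: Or43; apply/eqP; lia.
by apply/or4P; apply: Or44; apply/eqP; lia.
Qed.

(** Taking for k the last position of the maximum q bounds the letters after k by q - 1,
    which matches the weaker constraint that the wrap-around conditions give there. *)
Definition peaked (m q k : nat) (w : seq nat) : bool :=
  [&& kunz w, size w == m.-1, coord w k == q, all (leq^~ q) w &
   all (fun j => coord w j < q) (iota k.+1 (m - k.+1))].

Lemma peaked_exists w : kunz w -> ~~ all (fun a => a <= 3) w ->
  exists q k, [/\ 4 <= q <= sumn w, 0 < k < (size w).+1 & peaked (size w).+1 q k w].
Proof.
move=> kw; rewrite -has_predC => /hasP[a aw /= a3].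
pose q := \max_(a <- w) a.
have wq b : b \in w -> b <= q by move=> bw; exact: (@leq_bigmax_seq _ _ xpredT id).
have qw : q \in w.
  have w0 : 0 < size w by case: (w) aw.
  rewrite /q; elim: (w) w0 => // b [|c v] IH _; first by rewrite big_seq1 inE.
  rewrite big_cons /maxn; case: ifP => _; last by rewrite inE eqxx.
  by rewrite inE IH ?orbT.
have q4 : 4 <= q by rewrite (leq_trans _ (wq _ aw)) // ltnNge.
have qs : q <= sumn w.
  by rewrite sumnE (perm_big _ (perm_to_rem qw)) big_cons leq_addr.
have exk : exists k, (k <= size w) && (coord w k == q).
  exists (index q w).+1; rewrite index_mem qw /coord /=.
  by rewrite nth_index.
have [k /andP[kw' /eqP kq] kmax] := ex_maxnP exk (fun k => fun h => (andP h).1).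
have k0 : 0 < k by case: k kq kw' kmax => //=; rewrite /coord /=; lia.
exists q, k; rewrite q4 qs k0 ltnS kw' /peaked kw eqxx kq eqxx /=; split=> //.
apply/andP; split; first by apply/allP.
apply/allP => j; rewrite mem_iota => jk.
have aj : coord w j <= q by apply: coord_le; apply/allP.
rewrite ltn_neqAle aj andbT; apply/negP => jq.
by have := kmax j; rewrite jq andbT; lia.
Qed.

(** Both the largest letter allowed at j and the least sum of the letters at j and at
    its mirror image. *)
Definition level (q k j : nat) : nat := if j < k then q else q.-1.

Lemma mirror_ne m k j : 0 < j < m -> j != k -> k < m ->
  [/\ 0 < mirror m k j < m, mirror m k j != k & (mirror m k j < k) = (j < k)].
Proof.
move=> jm jk km; rewrite /mirror; rewrite ifF; last by apply/eqP; lia.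
move: jk; case: (ltngtP j k) => // h _; split; lia.
Qed.

Lemma peaked_pair m q k w j : peaked m q k w -> 0 < q -> 0 < k < m -> 0 < j < m -> j != k ->
  0 < coord w j <= level q k j /\ level q k j <= coord w j + coord w (mirror m k j).
Proof.
move=> /and5P[kw /eqP sw /eqP wk wq /allP wlt] q0 km jm jk.
have msw : m = (size w).+1 by lia.
have [pw k1 k2] := kunzP _ kw; rewrite -msw in pw k1 k2.
split.
  rewrite pw //= /level; case: ltnP => h; first exact: coord_le.
  by rewrite -ltnS prednK // wlt // mem_iota; move/eqP: jk; lia.
have j0 : (j == 0) = false by apply/eqP; lia.
rewrite /level /mirror j0.
move: jk; case: (ltngtP j k) => // jk _.
  by rewrite -wk; have := k1 j (k - j); rewrite subnKC ?(ltnW jk) //; apply; lia.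
have := k2 j (k + m - j); rewrite subnKC; last lia.
rewrite addnK wk => h; have {}h := h _ _ _; rewrite -subn1 leq_subLR add1n.
by apply: h; lia.
Qed.

Local Open Scope ring_scope.

Lemma sum_sub_seq (R : realType) (T : eqType) (f : T -> R) (s1 s2 : seq T) :
  (forall a, 0 <= f a) -> uniq s1 -> {subset s1 <= s2} ->
  \sum_(a <- s1) f a <= \sum_(a <- s2) f a.
Proof.
move=> f0; elim: s1 s2 => [|a s1 IH] s2 /=; first by rewrite big_nil sumr_ge0.
move=> /andP[as1 us1] sub; have as2 : a \in s2 by rewrite sub ?inE ?eqxx.
rewrite big_cons (perm_big _ (perm_to_rem as2)) big_cons lerD2l IH // => b bs1.
have := sub b; rewrite inE bs1 orbT => /(_ isT).
rewrite (perm_mem (perm_to_rem as2)) inE => /orP[/eqP ba|//].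
by rewrite -ba bs1 in as1.
Qed.

Lemma sum_ord_le (R : realType) (f : nat -> R) (P : pred nat) n (A : seq nat) :
  (forall a, 0 <= f a) -> (forall a, P a -> a \in A) ->
  \sum_(a < n | P a) f a <= \sum_(a <- A) f a.
Proof.
move=> f0 PA; rewrite -(big_mkord P f) -big_filter; apply: sum_sub_seq => //.
  by rewrite filter_uniq ?iota_uniq.
by move=> a; rewrite mem_filter => /andP[/PA].
Qed.

(** The two letters of a mirror pair satisfy [peaked_pair], so [reflection_bound] reduces
    the count to pair sums over the lists A j of admissible letters. The fixed points of
    the reflection cost the factor M ^+ 4. *)
Lemma peaked_bound (R : realType) m q k (L : seq (seq nat)) (x M : R) (h : nat -> R)
    (A : nat -> seq nat) :
  0 <= x -> 1 <= M -> (0 < q)%N -> (0 < k < m)%N -> uniq L ->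
  {in L, forall w, peaked m q k w /\
     forall j, (0 < j < m)%N -> j != k -> coord w j \in A j} ->
  (forall j, 0 < h j) ->
  (forall j, (0 < j < m)%N -> j != k ->
     pair_sum x (level q k j) (A j) (A (mirror m k j)) <= h j * h (mirror m k j)) ->
  (forall j, \sum_(a < q.+1) x ^+ a <= M * h j) ->
  \sum_(w <- L) x ^+ sumn w <= M ^+ 4 * \prod_(0 <= j < m) h j.
Proof.
move=> x0 M1 q0 km uL Lsh h0 hpair hfix.
have km' : (k < m)%N by case/andP: km.
pose ok (j : 'I_m) (a b : nat) := [&& a \in A j, b \in A (mirror m k j) &
  (level q k j <= a + b)%N].
have ne (j : 'I_m) : (j < mirror_ord k j)%N -> (0 < j < m)%N /\ (j : nat) != k.
  rewrite mirror_ordE // ltn_ord andbT /mirror; case: eqP => [->|/eqP j0]; first by rewrite ltnn.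
  rewrite lt0n j0; case: (ltngtP j k) => // ->; by rewrite ltnn.
have := @reflection_bound R m (mirror_ord k) (mirror_ordK km') q L x M (fun j => h j) ok
  x0 M1 _ uL _ (fun j => h0 j).
rewrite big_mkord => H; apply: le_trans (H _ _ _ _) _.
- lia.
- move=> w wL; have [sh wA] := Lsh _ wL.
  have /and5P[_ /eqP sw _ wq _] := sh; split=> // j; first exact: coord_le.
  move=> /ne[jm jk]; have [j1 j2] := peaked_pair sh q0 km jm jk.
  have [rm rk _] := mirror_ne jm jk km'.
  by rewrite /ok mirror_ordE // !wA.
- move=> j jsj; have [jm jk] := ne _ jsj; rewrite mirror_ordE //.
  apply: le_trans (hpair j jm jk).
  rewrite (bigID (fun a : 'I_q.+1 => (a : nat) \in A j)) /= [X in _ + X]big1 ?addr0.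
    apply: le_trans (sum_ord_le (A := A j) (P := fun a => a \in A j)
      (f := fun a => \sum_(b <- A (mirror m k j) | (level q k j <= a + b)%N) x ^+ (a + b)) _ _ _) => //.
      apply: ler_sum => a aA.
      rewrite -[leRHS]big_filter; apply: (sum_ord_le (P := ok j a) (f := fun b => x ^+ (a + b)%N)).
        by move=> b; rewrite exprn_ge0.
      by move=> b /and3P[_ bA ab]; rewrite mem_filter ab.
    by move=> a; apply: sumr_ge0 => b _; rewrite exprn_ge0.
  by move=> a /negPf aA; rewrite big1 // => b; rewrite /ok aA.
- by move=> j _; exact: hfix.
- rewrite ler_wpM2r ?prodr_ge0 // => [j _|]; first exact: ltW.
  exact: (ler_weXn2l M1 (card_mirror_fix km')).
Qed.

End PeakedWords.

(** * The upper bound *)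

Section UpperBound.
Local Open Scope ring_scope.

Section upper.
Variable R : realType.
Notation x := (x1 R).
Notation gam := (gam R).
Notation mu := (mu R).

Lemma x1_gt0 : 0 < x. Proof. rewrite /x1; lra. Qed.

Lemma sum_geom_le n : \sum_(a < n) x ^+ a <= 3.
Proof.
have e := subrX1 x n; have e' : x - 1 = - (39 / 110) by rewrite /x1; lra.
rewrite e' in e.
have xn : 0 <= x ^+ n by rewrite exprn_ge0 // ltW // x1_gt0.
lra.
Qed.

(** Let W(s) be the weight of the pairs of letters in [1, s] with sum >= s. Splitting off
    the first letter s + 1 and lowering the second letter by one in the other pairs gives
    W(s + 1) <= x W(s) + x^(s+1) (1 + x + x^2 + ...), and W(6) < 1. *)
Lemma pair_sum_full_le s : (6 <= s)%N -> pair_sum x s (vals 1 s) (vals 1 s) <= 1.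
Proof.
have x0 := x1_gt0.
have e6 : pair_sum x 6 (vals 1 6) (vals 1 6) <= 1.
  have -> : 1 = weight R 0 0 0 0 by rewrite /weight !expr0; lra.
  by apply: pair_sum_check => //; vm_compute.
elim: s => // s IH; rewrite leq_eqVlt => /orP[/eqP <- //|]; rewrite ltnS => s6.
have {}IH := IH s6.
have rE n : vals 1 n = iota 1 n by rewrite /vals subn1.
rewrite /pair_sum !rE in IH *.
have iS : iota 1 s.+1 = iota 1 s ++ [:: s.+1] by rewrite -{1}(addn1 s) iotaD add1n.
have x1le n : (7 <= n)%N -> x ^+ n <= x ^+ 7.
  by move=> n7; apply: ler_wiXn2l; [exact: ltW|rewrite /x1; lra|].
rewrite {1}iS big_cat /= big_seq1.
have H1 : \sum_(a <- iota 1 s) \sum_(b <- iota 1 s.+1 | (s < a + b)%N) x ^+ (a + b)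
   <= x ^+ 7 + x * \sum_(a <- iota 1 s) \sum_(b <- iota 1 s | (s <= a + b)%N) x ^+ (a + b).
  apply: le_trans (_ : \sum_(a <- iota 1 s) ((if (a == s)%N then x ^+ 7 else 0) +
     x * \sum_(b <- iota 1 s | (s <= a + b)%N) x ^+ (a + b)) <= _).
    rewrite big_seq [leRHS]big_seq; apply: ler_sum => a; rewrite mem_iota => a1s.
    rewrite /= big_cons addn1 ltnS (iotaDl 1 1) big_map mulr_sumr.
    have -> : \sum_(j <- iota 1 s | (s < a + (1 + j))%N) x ^+ (a + (1 + j)) =
      \sum_(b <- iota 1 s | (s <= a + b)%N) x * x ^+ (a + b).
      apply: eq_big => b; first by rewrite addnCA add1n ltnS.
      by move=> _; rewrite addnCA add1n exprS.
    have -> : (s <= a)%N = (a == s) by lia.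
    case: ifP => [/eqP sa|_]; last by rewrite add0r.
    by rewrite lerD2r; apply: x1le; lia.
  rewrite [leLHS]big_split /= mulr_sumr lerD2r.
  rewrite (bigD1_seq s) ?mem_iota ?iota_uniq //=; last lia.
  by rewrite eqxx big1 ?addr0 // => a /negPf ->.
have H2 : \sum_(b <- iota 1 s.+1 | (s < s.+1 + b)%N) x ^+ (s.+1 + b) <= x ^+ 7 * 3.
  apply: le_trans (_ : x ^+ s.+1 * \sum_(b <- iota 1 s.+1) x ^+ b <= _).
    rewrite mulr_sumr big_mkcond; apply: ler_sum => b _; rewrite exprD.
    by case: ifP => // _; rewrite mulr_ge0 // exprn_ge0 // ltW.
  apply: ler_pM; [exact/exprn_ge0/ltW| |exact: x1le|].
    by rewrite sumr_ge0 // => b _; exact/exprn_ge0/ltW.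
  apply: le_trans (sum_geom_le s.+2).
  rewrite -(big_mkord xpredT (fun b => x ^+ b)) /index_iota subn0.
  by rewrite -[iota 0 _]/(0%N :: iota 1 s.+1) big_cons lerDr expr0.
have H3 : x ^+ 7 <= 6 / 100 by rewrite /x1; lra.
have H4 : x * \sum_(a <- iota 1 s) \sum_(b <- iota 1 s | (s <= a + b)%N) x ^+ (a + b) <= x * 1.
  by rewrite ler_pM2l.
have H5 : x <= 7 / 10 by rewrite /x1; lra.
by apply: le_trans (lerD H1 H2) _; lra.
Qed.

Lemma union_bound (T : finType) (W : eqType) (C : pred T) (P : T -> pred W) (L : seq W)
    (f : W -> R) :
  (forall w, 0 <= f w) -> {in L, forall w, exists2 c, C c & P c w} ->
  \sum_(w <- L) f w <= \sum_(c | C c) \sum_(w <- L | P c w) f w.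
Proof.
move=> f0 LP; rewrite (eq_bigr (fun c => \sum_(w <- L) (if P c w then f w else 0))); last first.
  by move=> c _; rewrite -big_mkcond.
rewrite exchange_big /= big_seq [leRHS]big_seq; apply: ler_sum => w wL.
have [c Cc Pc] := LP w wL.
rewrite (bigD1 c) //= Pc lerDl sumr_ge0 // => c' _; by case: ifP.
Qed.

(** The product of all potentials is controlled by the cardinal inequality satisfied by
    the sets of a certificate. *)
Lemma prod_potential (y : R) (a b c : nat -> bool) K e : 1 <= y ->
  (\sum_(0 <= j < K) a j + \sum_(0 <= j < K) b j <=
   \sum_(0 <= j < K) c j + K + e)%N ->
  \prod_(0 <= j < K) (y ^+ (a j + b j) / y ^+ (c j).+1) <= y ^+ e.
Proof.
move=> y1; have y0 : 0 < y by lra.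
rewrite big_split /= prodfV !prodrXr -!big_split /= => h.
rewrite ler_pdivrMr ?exprn_gt0 // -exprD; apply: ler_weXn2l => //.
have -> : (\sum_(0 <= j < K) (c j).+1 = \sum_(0 <= j < K) c j + K)%N.
  under eq_bigr do rewrite -addn1; rewrite big_split /= sum_nat_const_nat; lia.
by move: h; rewrite big_split /=; lia.
Qed.

(** The error term for D = psi^2: it is o(m) when psi tends to infinity slowly, and it
    bounds both the defect in the cardinal inequality and the size of certificates. *)
Definition excess (psi m : nat) : nat := ((psi ^ 2).*2 + m %/ psi + 1)%N.

Lemma cover_excess m K psi (G F : {set 'I_m}) : (0 < psi)%N -> (#|G| <= psi ^ 2)%N ->
  (cnt K (cand_u K (psi ^ 2) psi G F) + cnt K (cand_v K (psi ^ 2) G) <=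
   cnt K (capped K (psi ^ 2) G F) + K + excess psi K)%N.
Proof.
move=> p0 Gp; have pp : (0 < psi ^ 2)%N by rewrite expn_gt0 p0.
have := cover_card K psi F pp Gp; rewrite /excess.
set u := cnt _ _; set v := cnt _ _; set n := cnt _ _; set d := (psi ^ 2)%N => h.
have kp : (psi * K <= d * (K %/ psi + 1))%N.
  rewrite /d expnS expn1 -mulnA leq_mul2l (gtn_eqF p0) /= addn1.
  by rewrite mulnC ltnW // ltn_ceil.
have : (d * (u + v) <= d * (n + K + (d.*2 + K %/ psi + 1)))%N by nia.
by rewrite leq_mul2l (gtn_eqF pp).
Qed.

Definition compatible (m K D psi u v : nat) (GF : {set 'I_m} * {set 'I_m}) (w : seq nat) : bool :=
  all (fun j => [&& (coord w j <= u)%N ==> cand_u K D psi GF.1 GF.2 j,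
    (coord w j <= v)%N ==> cand_v K D GF.1 j &
    capped K D GF.1 GF.2 j ==> (coord w j <= u + v)%N]) (iota 1 K.-1).

Definition small (m e : nat) (GF : {set 'I_m} * {set 'I_m}) : bool :=
  (#|GF.1| <= e)%N && (#|GF.2| <= e)%N.

Lemma compatible_exists m K psi u v w : (0 < psi)%N -> (u <= v)%N -> (K <= m)%N ->
  kunz w -> size w = m.-1 -> (0 < m)%N ->
  exists GF : {set 'I_m} * {set 'I_m}, [/\ (#|GF.1| <= psi ^ 2)%N, small (excess psi m) GF &
    compatible K (psi ^ 2) psi u v GF w].
Proof.
move=> p0 uv Km kw sw m0; have [_ k1 _] := kunzP _ kw.
have [G [F [GD Fp H]]] := @cover_exists m K (psi ^ 2) psi (coord w) u v uv Km
  (fun i j ij => k1 i j ltac:(lia)).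
exists (G, F); split=> //=.
  rewrite /small /excess /=; apply/andP; split.
    by apply: leq_trans GD _; rewrite -addnn -!addnA leq_addr.
  have : (#|F| <= m %/ psi)%N by rewrite leq_divRL // mulnC.
  by move=> h; rewrite (leq_trans h) // addnAC leq_addl.
apply/allP => j; rewrite mem_iota => jK; have [|h1 h2 h3] := H j; first lia.
by apply/and3P; split; apply/implyP.
Qed.

(** Each set of size at most e has weight at least t^e in the expansion of (1 + t)^m. *)
Lemma card_small_sets m e (t : R) : 0 < t <= 1 ->
  #|[pred S : {set 'I_m} | (#|S| <= e)%N]|%:R <= t ^- e * (1 + t) ^+ m.
Proof.
move=> /andP[t0 t1].
have -> : (1 + t) ^+ m = \sum_(S : {set 'I_m}) t ^+ #|S|.
  rewrite -[m in LHS]card_ord -prodr_const addrC bigA_distr; apply: eq_bigr => S _.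
  by rewrite -prodr_const [RHS]big_mkcond.
rewrite -ler_pdivrMl ?invr_gt0 ?exprn_gt0 // invrK mulrC.
rewrite mulr_natl -sumr_const big_mkcond; apply: ler_sum => S _.
rewrite inE; case: ifP => [h|_]; last by rewrite exprn_ge0 // ltW.
by apply: ler_wiXn2l => //; exact: ltW.
Qed.

End upper.

Lemma mem_vals lo hi a : (lo <= a <= hi)%N -> a \in vals lo hi.
Proof. by rewrite /vals mem_iota; lia. Qed.

Lemma cand_uv m K D psi (G F : {set 'I_m}) j : cand_u K D psi G F j ==> cand_v K D G j.
Proof. by apply/implyP => /andP[]. Qed.

Lemma compatible_bounds m K D psi GF w j : @compatible m K D psi 1 2 GF w -> (0 < j < K)%N ->
  (0 < coord w j)%N ->
  (lowest (cand_u K D psi GF.1 GF.2 j) (cand_v K D GF.1 j) <= coord w j)%N /\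
  (capped K D GF.1 GF.2 j -> coord w j <= 3)%N.
Proof.
move=> /allP/(_ j) + jK w0; rewrite mem_iota => /(_ _)/and3P[|/implyP h1 /implyP h2 /implyP h3].
  lia.
split=> //; rewrite /lowest; case: ifP => // /negP hU; case: ifP => [_|/negP hV].
  by rewrite ltnNge; apply/negP => /h1.
by rewrite ltnNge; apply/negP => /h2.
Qed.

Section cases.
Variable R : realType.
Notation x := (x1 R).
Notation gam := (gam R).
Notation mu := (mu R).

Definition num_small (m e : nat) : R := #|[pred S : {set 'I_m} | (#|S| <= e)%N]|%:R.

Lemma num_small_ge1 m e : 1 <= num_small m e.
Proof.
rewrite /num_small ler1n; apply/card_gt0P; exists boot.finset.set0.
by rewrite inE boot.finset.cards0.
Qed.

Lemma card_small m e : #|[pred c | @small m e c]|%:R = num_small m e ^+ 2.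
Proof. by rewrite expr2 -natrM -cardX; congr (_%:R); apply: eq_card => c; rewrite !inE. Qed.

(** The factor 6 is chosen so that 3, a bound for the full geometric series, is at most
    6 times any potential. *)
Lemma peaked_filter m q k (L : seq (seq nat)) (P : pred (seq nat)) (M : R) (h : nat -> R)
    (A : nat -> seq nat) :
  1 <= M -> (0 < q)%N -> (0 < k < m)%N -> uniq L -> {in L, forall w, peaked m q k w} ->
  (forall w j, peaked m q k w -> P w -> (0 < j < m)%N -> j != k -> coord w j \in A j) ->
  (forall j, 1 / 2 <= h j) ->
  (forall j, (0 < j < m)%N -> j != k ->
     pair_sum x (level q k j) (A j) (A (mirror m k j)) <= h j * h (mirror m k j)) ->
  \prod_(0 <= j < m) h j <= M ->
  \sum_(w <- L | P w) x ^+ sumn w <= 6 ^+ 4 * M.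
Proof.
move=> M1 q0 km uL Lsh wA h2 hpair hM.
have x0 := x1_gt0 R; rewrite -big_filter.
apply: le_trans (@peaked_bound R m q k _ x 6 h A (ltW x0) _ q0 km (filter_uniq _ uL) _ _ hpair _) _.
- lra.
- move=> w; rewrite mem_filter => /andP[Pw /Lsh sh]; split=> // j jm jk.
  exact: (wA w j).
- by move=> j; have := h2 j; lra.
- by move=> j; have := h2 j; have := sum_geom_le R q.+1; lra.
- by rewrite ler_wpM2l // exprn_ge0 //; lra.
Qed.

(** The trivial potential 1 works, by [pair_sum_full_le]. *)
Lemma peaked_sum_large m q k (L : seq (seq nat)) : (7 <= q)%N -> (0 < k < m)%N -> uniq L ->
  {in L, forall w, peaked m q k w} -> \sum_(w <- L) x ^+ sumn w <= 6 ^+ 4.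
Proof.
move=> q7 km uL Lsh; have q0 : (0 < q)%N by lia.
have km' : (k < m)%N by lia.
have := @peaked_filter m q k L xpredT 1 (fun=> 1) (fun j => vals 1 (level q k j)) _ q0 km uL Lsh.
move=> H; rewrite -[leRHS]mulr1; apply: H => //.
- by move=> w j sh _ jm jk; apply: mem_vals; have [] := peaked_pair sh q0 km jm jk.
- by move=> _; lra.
- move=> j jm jk; have [_ _ rl] := mirror_ne jm jk km'.
  by rewrite mulr1 {3}/level rl -/(level q k j); apply: pair_sum_full_le; rewrite /level; case: ifP; lia.
- by rewrite big1.
Qed.

Lemma peaked_sum_56 m q k psi (L : seq (seq nat)) : (5 <= q <= 6)%N -> (0 < k < m)%N ->
  (0 < psi)%N -> uniq L -> {in L, forall w, peaked m q k w} ->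
  \sum_(w <- L) x ^+ sumn w <=
  num_small m (excess psi m) ^+ 2 * (6 ^+ 4 * gam ^+ excess psi m).
Proof.
move=> q56 km p0 uL Lsh; have q0 : (0 < q)%N by lia.
have km' : (k < m)%N by lia.
have x0 := x1_gt0 R; have gam1 := gam_ge1 R.
pose D := (psi ^ 2)%N; set e := excess psi m.
apply: le_trans (_ : \sum_(c | @small m e c && (#|c.1| <= D)%N)
   \sum_(w <- L | compatible m D psi 1 2 c w) x ^+ sumn w <= _).
  apply: union_bound => [w|w /Lsh/and5P[kw /eqP sw _ _ _]]; first exact/exprn_ge0/ltW.
  have [|c [cD cs cc]] := @compatible_exists m m psi 1 2 w p0 isT (leqnn m) kw sw; first lia.
  by exists c => //; rewrite cs.
apply: le_trans (_ : \sum_(c | @small m e c && (#|c.1| <= D)%N) 6 ^+ 4 * gam ^+ e <= _).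
  apply: ler_sum => -[G F] /andP[_ /= GD].
  pose qu := cand_u m D psi G F; pose qv := cand_v m D G; pose nn := capped m D G F.
  apply: (@peaked_filter m q k L _ _ (fun j => weight12 R (qu j) (qv j) (nn j))
    (fun j => vals (lowest (qu j) (qv j)) (if nn j then 3 else level q k j))) => //.
  - exact: exprn_ege1.
  - move=> w j sh cw jm jk; have [/andP[w0 ws] _] := peaked_pair sh q0 km jm jk.
    have [lo hi] := compatible_bounds cw jm w0.
    by apply: mem_vals; rewrite lo /=; case: ifP.
  - by move=> j; apply: weight_ge => //; case: (nn j).
  - move=> j jm jk; have [_ _ rl] := mirror_ne jm jk km'.
    have -> : level q k (mirror m k j) = level q k j by rewrite /level rl.
    by apply: pair_sum_le12; rewrite ?cand_uv // /level; case: ifP; lia.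
  - have := @prod_potential R gam qu qv nn m e gam1 (cover_excess m F p0 GD).
    by apply: le_trans; rewrite le_eqVlt; apply/orP; left; apply/eqP/eq_bigr => j _;
      rewrite /weight12 /weight !expr0 !mul1r.
rewrite -card_small mulr_natl -sumr_const big_mkcond [leRHS]big_mkcond.
apply: ler_sum => c _; rewrite inE; case: (small _ _) => //=; case: ifP => // _.
by rewrite mulr_ge0 // exprn_ge0 //; lra.
Qed.

(** After the maximum only letters 1, 2, 3 remain, so (1, 2) gives nothing there; the
    second certificate is taken on the positions before k only. *)
Lemma peaked_sum_4 m k psi (L : seq (seq nat)) : (0 < k < m)%N ->
  (0 < psi)%N -> uniq L -> {in L, forall w, peaked m 4 k w} ->
  \sum_(w <- L) x ^+ sumn w <=
  num_small m (excess psi m) ^+ 4 * (6 ^+ 4 * (mu ^+ excess psi m * gam ^+ excess psi m)).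
Proof.
move=> km p0 uL Lsh; have km' : (k < m)%N by lia.
have x0 := x1_gt0 R; have gam1 := gam_ge1 R.
have mu1 := mu_ge1 R.
pose D := (psi ^ 2)%N; set e := excess psi m.
pose C (c : ({set 'I_m} * {set 'I_m}) * ({set 'I_m} * {set 'I_m})) :=
  [&& @small m e c.1, @small m e c.2, (#|c.1.1| <= D)%N & (#|c.2.1| <= D)%N].
apply: le_trans (_ : \sum_(c | C c) \sum_(w <- L | compatible m D psi 1 1 c.1 w &&
    compatible k D psi 1 2 c.2 w) x ^+ sumn w <= _).
  apply: union_bound => [w|w /Lsh/and5P[kw /eqP sw _ _ _]]; first exact/exprn_ge0/ltW.
  have m0 : (0 < m)%N by lia.
  have [c [cD cs cc]] := @compatible_exists m m psi 1 1 w p0 isT (leqnn m) kw sw m0.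
  have [d [dD ds dd]] := @compatible_exists m k psi 1 2 w p0 isT (ltnW km') kw sw m0.
  by exists (c, d); rewrite /C /= ?cs ?ds ?cD ?dD ?cc.
apply: le_trans (_ : \sum_(c | C c) 6 ^+ 4 * (mu ^+ e * gam ^+ e) <= _).
  apply: ler_sum => -[[Ga Fa] [Gb Fb]] /and4P[_ _ /= GaD GbD].
  pose qa := cand_u m D psi Ga Fa; pose na := capped m D Ga Fa.
  pose qu := cand_u k D psi Gb Fb; pose qv := cand_v k D Gb; pose nn := capped k D Gb Fb.
  apply: (@peaked_filter m 4 k L _ _
    (fun j => weight11 R (qa j) (na j) * (if (j < k)%N then weight12 R (qu j) (qv j) (nn j) else 1))
    (fun j => if (j < k)%N then
        vals (lowest (qa j && qu j) (qv j)) (if na j then 2 else if nn j then 3 else 4)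
      else vals (if qa j then 1 else 2) (if na j then 2 else 3))) => //.
  - by rewrite -[leLHS](mulr1 1); apply: ler_pM => //; exact: exprn_ege1.
  - move=> w j sh /andP[ca cb] jm jk.
    have [/andP[w0 ws] _] := peaked_pair sh (isT : (0 < 4)%N) km jm jk.
    move/allP: ca => /(_ j); rewrite mem_iota => /(_ _)/and3P[|/implyP h1 _ /implyP h3].
      lia.
    rewrite /level in ws; case: ltnP ws => jk' ws.
      have jk0 : (0 < j < k)%N by case/andP: jm => ->.
      have [lo hi] := compatible_bounds cb jk0 w0.
      apply: mem_vals; apply/andP; split.
        move: lo; rewrite /lowest -/qu -/qv; case: (boolP (qu j)) => [qj _|_]; last by rewrite andbF.
        rewrite andbT; case: (boolP (qa j)) => [//|nqa].
        have qvj : qv j by apply: (implyP (cand_uv k D psi Gb Fb j)).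
        rewrite qvj.
        by rewrite ltnNge; apply/negP => /h1; apply/negP.
      by case: ifP => [/h3 //|_]; case: ifP.
    apply: mem_vals; apply/andP; split; last by case: ifP => [/h3|].
    by case: ifP => [//|/negP nqa]; rewrite ltnNge; apply/negP => /h1.
  - move=> j; case: ifP => _; rewrite /weight11 /weight12 ?mulr1 ?weightM; apply: weight_ge.
    + by case: (na j).
    + by case: (nn j).
    + by case: (na j).
    + by [].
  - move=> j jm jk; have [_ _ rl] := mirror_ne jm jk km'; rewrite /level rl.
    case: ifP => jk'; last by rewrite !mulr1; exact: pair_sum_le11.
    have lo3P (b1 b2 : bool) : lowest b1 b2 \in iota 1 3 by case: b1; case: b2.
    have hiP (b1 b2 : bool) : (if b1 then 2 else if b2 then 3 else 4)%N \in iota 2 3.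
      by case: b1; case: b2.
    apply: le_trans (pair_sum_le4 R (lo3P _ _) (hiP _ _) (lo3P _ _) (hiP _ _)) _.
    by apply: ler_pM; rewrite ?weight4_le ?cand_uv // /weight4 /weight11 /weight12 weightM ltW // weight_gt0.
  - rewrite big_split /=; apply: ler_pM.
    + by apply: prodr_ge0 => j _; exact/ltW/weight_gt0.
    + by apply: prodr_ge0 => j _; case: ifP => // _; exact/ltW/weight_gt0.
    + have h1 := cover_excess m Fa p0 GaD.
      have h2 : (cnt m (cand_u m D psi Ga Fa) <= cnt m (cand_v m D Ga))%N.
        apply: leq_sum => j _; have := cand_uv m D psi Ga Fa j.
        by case: cand_u => //=; case: cand_v.
      have h3 : (cnt m qa + cnt m qa <= cnt m na + m + e)%N.
        by apply: leq_trans h1; rewrite leq_add2l.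
      have := @prod_potential R mu qa qa na m e mu1 h3.
      apply: le_trans; rewrite le_eqVlt; apply/orP; left; apply/eqP/eq_bigr => j _.
      by rewrite /weight11 /weight !expr0 !mulr1.
    have h1 := cover_excess k Fb p0 GbD.
    rewrite (@big_cat_nat _ _ _ k) //= ?(ltnW km') // [X in _ * X]big_nat.
    rewrite [X in _ * X]big1 ?mulr1; last by move=> j /andP[kj _]; rewrite ltnNge kj.
    apply: le_trans (_ : gam ^+ excess psi k <= _).
      have := @prod_potential R gam qu qv nn k _ gam1 h1.
      apply: le_trans; rewrite le_eqVlt; apply/orP; left; apply/eqP.
      by apply: eq_big_nat => j /andP[_ jk]; rewrite jk /weight12 /weight !expr0 !mul1r.
    apply: ler_weXn2l => //; rewrite /e /excess leq_add2r leq_add2l.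
    exact: leq_div2r (ltnW km').
have -> : num_small m e ^+ 4 = #|[predX [pred c | @small m e c] & [pred c | @small m e c]]|%:R.
  by rewrite cardX natrM card_small -exprD.
rewrite mulr_natl -sumr_const big_mkcond [leRHS]big_mkcond.
apply: ler_sum => c _; rewrite !inE /C; case: (small _ _) => //=.
case: (small _ _) => //=; case: ifP => // _.
by rewrite mulr_ge0 ?exprn_ge0 ?mulr_ge0 ?exprn_ge0 //; lra.
Qed.

Lemma peaked_sum_le m q k psi (L : seq (seq nat)) : (4 <= q)%N -> (0 < k < m)%N ->
  (0 < psi)%N -> uniq L -> {in L, forall w, peaked m q k w} ->
  \sum_(w <- L) x ^+ sumn w <=
  num_small m (excess psi m) ^+ 4 * (6 ^+ 4 * 2 ^+ excess psi m).
Proof.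
move=> q4 km p0 uL Lsh; set e := excess psi m.
have N1 := num_small_ge1 m e.
have gam1 := gam_ge1 R.
have mu1 := mu_ge1 R.
have p6 : 0 < 6 ^+ 4 :> R by rewrite exprn_gt0 //; lra.
have two : 1 <= 2 ^+ e :> R by apply: exprn_ege1; lra.
have N4 : 1 <= num_small m e ^+ 4 by apply: exprn_ege1.
have [q7|q7] := leqP 7 q.
  apply: le_trans (peaked_sum_large q7 km uL Lsh) _.
  rewrite mulrCA -[leLHS]mulr1 ler_pM2l // -[leLHS]mulr1.
  by apply: ler_pM.
have [q5|q5] := leqP 5 q.
  apply: le_trans (peaked_sum_56 (q := q) (psi := psi) _ km p0 uL Lsh) _; first lia.
  apply: ler_pM; rewrite ?exprn_ge0 ?mulr_ge0 ?exprn_ge0 //; try lra.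
    by apply: ler_weXn2l.
  rewrite ler_pM2l //; apply: lerXn2r; rewrite ?nnegrE; try lra.
  by apply: le_trans (mu_gam_le2 R); rewrite ler_peMl //; lra.
have q4' : q = 4 by lia.
subst q; apply: le_trans (peaked_sum_4 km p0 uL Lsh) _.
apply: ler_wpM2l; first by rewrite exprn_ge0 //; lra.
rewrite ler_pM2l // -exprMn; apply: lerXn2r; rewrite ?nnegrE.
- by apply: mulr_ge0; lra.
- lra.
- exact: mu_gam_le2.
Qed.

End cases.

Section final.
Variable R : realType.
Notation x := (x1 R).

Lemma root_gt1 (z : R) n : 1 < z -> (0 < n)%N -> exists2 y : R, 1 < y & y ^+ n = z.
Proof.
move=> z1 n0; have nR : (n%:R : R) != 0 by rewrite pnatr_eq0 -lt0n.
exists (z `^ n%:R^-1); last by rewrite -powR_mulrn ?powR_ge0 // -powRrM mulVf // powRr1 //; lra.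
have h1 : 1 `^ n%:R^-1 = 1 :> R by rewrite powR1.
rewrite -[ltLHS]h1; apply: gt0_ltr_powR; rewrite ?nnegrE ?invr_gt0 ?ltr0n //; lra.
Qed.

(** The number of sets of size <= e is at most t^(-e) (1 + t)^m. One first takes t small
    enough for (1 + t)^4 to be harmless, and then psi so large that a constant to the
    power m / psi is harmless too. *)
Lemma small_growth (z : R) : 1 < z -> exists2 psi, (0 < psi)%N & exists2 C : R, 0 < C &
  forall m, num_small R m (excess psi m) ^+ 4 * (6 ^+ 4 * 2 ^+ excess psi m) <= C * z ^+ m.
Proof.
move=> z1; have [y y1 yz] := root_gt1 z1 (isT : (0 < 5)%N).
pose t := Num.min 1 (y - 1).
have t0 : 0 < t by rewrite /t lt_min; apply/andP; split; lra.
have t1 : t <= 1 by rewrite /t ge_min lexx.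
have ty : 1 + t <= y by have : t <= y - 1; [rewrite /t ge_min lexx orbT|lra].
pose a := t ^- 4 * 2.
have a1 : 1 <= a.
  rewrite /a; have : 1 <= t ^- 4.
    rewrite -[leLHS]invr1 lef_pV2 ?posrE ?exprn_gt0 //.
    by apply: exprn_ile1 => //; exact: ltW.
  lra.
have [N hN] := expr_large a y1.
pose psi := N.+1; have psi0 : (0 < psi)%N by [].
exists psi => //.
exists (6 ^+ 4 * a ^+ ((psi ^ 2).*2 + 1)).
  by rewrite mulr_gt0 ?exprn_gt0 //; lra.
move=> m; set e := excess psi m.
have h1 : num_small R m e <= t ^- e * (1 + t) ^+ m by apply: card_small_sets; rewrite t0.
have h2 : num_small R m e ^+ 4 <= (t ^- e * y ^+ m) ^+ 4.
  apply: lerXn2r; rewrite ?nnegrE ?ler0n ?mulr_ge0 ?invr_ge0 ?exprn_ge0 //; try lra.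
  apply: le_trans h1 _; rewrite ler_pM2l ?invr_gt0 ?exprn_gt0 //.
  by apply: lerXn2r; rewrite ?nnegrE; lra.
have h3 : a ^+ (m %/ psi) <= y ^+ m.
  apply: le_trans (_ : (y ^+ psi) ^+ (m %/ psi) <= _).
    by apply: lerXn2r; rewrite ?nnegrE ?exprn_ge0 ?(hN psi) //; lra.
  rewrite -exprM; apply: ler_weXn2l; first exact: ltW.
  by rewrite mulnC leq_divM.
apply: le_trans (_ : (t ^- e * y ^+ m) ^+ 4 * (6 ^+ 4 * 2 ^+ e) <= _).
  by rewrite ler_wpM2r // mulr_ge0 ?exprn_ge0 //; lra.
have -> : (t ^- e * y ^+ m) ^+ 4 * (6 ^+ 4 * 2 ^+ e) = 6 ^+ 4 * a ^+ e * (y ^+ m) ^+ 4.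
  rewrite /a !exprMn -!exprVn -!exprM [(e * 4)%N]mulnC; ring.
have -> : e = ((psi ^ 2).*2 + 1 + m %/ psi)%N by rewrite /e /excess addnAC.
rewrite exprD mulrA -mulrA ler_pM2l; last by rewrite mulr_gt0 ?exprn_gt0 //; lra.
have -> : z ^+ m = y ^+ m * (y ^+ m) ^+ 4 by rewrite -yz -exprS -!exprM mulnC.
by rewrite ler_pM2r // !exprn_gt0 //; lra.
Qed.

(** A deep word determines m, q and k, so there are at most (g + 2)^3 classes. *)
Lemma ndeep_le (z : R) : 1 < z -> exists2 C : R, 0 < C & forall g,
  (ndeep g)%:R * x ^+ g <= g.+2%:R ^+ 3 * (C * z ^+ g.+2).
Proof.
move=> z1; have [psi p0 [C C0 hC]] := small_growth z1.
have x0 := x1_gt0 R.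
exists C => // g.
pose NL := [seq w <- compositions g | kunz w && ~~ all (fun a => a <= 3)%N w].
pose Cp (c : 'I_g.+2 * 'I_g.+2 * 'I_g.+2) := (4 <= c.1.2)%N && (0 < c.2 < c.1.1)%N.
have -> : (ndeep g)%:R * x ^+ g = \sum_(w <- NL) x ^+ sumn w.
  rewrite (eq_big_seq (fun=> x ^+ g)); last first.
    by move=> w; rewrite mem_filter mem_compositions => /andP[_ /andP[_ /eqP ->]].
  by rewrite big_const_seq count_predT iter_addr_0 size_filter mulr_natl.
apply: le_trans (_ : \sum_(c | Cp c)
   \sum_(w <- NL | peaked c.1.1 c.1.2 c.2 w) x ^+ sumn w <= _).
  apply: union_bound => [w|w]; first exact/exprn_ge0/ltW.
  rewrite mem_filter mem_compositions => /andP[/andP[kw w3] /andP[pw /eqP sw]].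
  have [q [k [qs km sh]]] := peaked_exists kw w3.
  have szg : (size w <= g)%N.
    rewrite -sw; elim: (w) pw => //= a v IH /andP[a0 /IH]; lia.
  have h1 : ((size w).+1 < g.+2)%N by [].
  have h2 : (q < g.+2)%N by lia.
  have h3 : (k < g.+2)%N by case/andP: km => _ km2; apply: leq_trans km2 _; exact: ltnW.
  exists (Ordinal h1, Ordinal h2, Ordinal h3) => //=.
  by rewrite /Cp /= km andbT; case/andP: qs.
apply: le_trans (_ : \sum_(c : 'I_g.+2 * 'I_g.+2 * 'I_g.+2) C * z ^+ g.+2 <= _).
  rewrite big_mkcond; apply: ler_sum => -[[m q] k] _.
  have pos : 0 <= C * z ^+ g.+2 by rewrite mulr_ge0 ?exprn_ge0 //; lra.
  case: ifP => [/andP[/= q4 km]|_] //.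
  rewrite -big_filter.
  apply: le_trans (@peaked_sum_le R m q k psi _ q4 km p0 _ _) _.
  - by rewrite !filter_uniq // uniq_compositions.
  - by move=> w; rewrite mem_filter => /andP[].
  apply: le_trans (hC m) _; rewrite ler_pM2l //.
  by apply: ler_weXn2l; [exact: ltW|exact: ltnW (ltn_ord m)].
by rewrite sumr_const !card_prod !card_ord -[leLHS]mulr_natl -natrX !expnS expn0 muln1 mulnA.
Qed.

Lemma r154_spec : let y : R := (r154 R)^-1 in 0 < y /\
  y ^+ 4 * (y + 1) ^+ 2 * (y ^+ 4 + 2 * y ^+ 3 + y ^+ 2 + 1) = 1.
Proof.
move=> y; have [y0 /rootP + _] := r154P R; rewrite horner_poly154 => h.
by split=> //; apply/eqP; rewrite -subr_eq0; apply/eqP.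
Qed.

(** The polynomial defining r154 is increasing and already positive at x1. *)
Lemma r154_gt : 1 < r154 R * x.
Proof.
have [y0 h] := r154_spec; set y := _^-1 in y0 h.
have x0 := x1_gt0 R.
have rE : r154 R = y^-1 by rewrite /y invrK.
rewrite rE; clearbody y; rewrite ltr_pdivlMl // mulr1 ltNge; apply/negP => xy.
have hx : 1 < x ^+ 4 * (x + 1) ^+ 2 * (x ^+ 4 + 2 * x ^+ 3 + x ^+ 2 + 1).
  by rewrite /x1; lra.
have pw n : x ^+ n <= y ^+ n by apply: lerXn2r; rewrite ?nnegrE // ltW.
have p2 : (x + 1) ^+ 2 <= (y + 1) ^+ 2 by apply: lerXn2r; rewrite ?nnegrE; lra.
have x_ n : 0 <= x ^+ n by rewrite exprn_ge0 // ltW.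
have : x ^+ 4 * (x + 1) ^+ 2 * (x ^+ 4 + 2 * x ^+ 3 + x ^+ 2 + 1) <=
   y ^+ 4 * (y + 1) ^+ 2 * (y ^+ 4 + 2 * y ^+ 3 + y ^+ 2 + 1).
  apply: ler_pM.
  - by rewrite mulr_ge0 ?exprn_ge0 //; lra.
  - by have := x_ 4; have := x_ 3; have := x_ 2; lra.
  - by apply: ler_pM => //; rewrite ?exprn_ge0 //; lra.
  by have := pw 4; have := pw 3; have := pw 2; lra.
by rewrite h; lra.
Qed.

Lemma nhat_le_r154 : (limsup_root R nhat_ <= (r154 R)%:E)%E.
Proof.
have x0 := x1_gt0 R; have r1 := r154_gt.
have r0 : 0 < r154 R by have [y0 _ _] := r154P R; rewrite -invr_gt0.
have [z z1 zE] := root_gt1 r1 (isT : (0 < 5)%N).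
have [C C0 hC] := ndeep_le z1.
have [B B1 hB] := natr_le_expr z1.
have [N hN] := expr_large (B ^+ 3 * z ^+ 5 * C) z1.
rewrite nhat_ndeep; apply: (@limsup_root_le _ _ _ N); first exact: ltW.
move=> g /hN Ng; have xg : 0 < x ^+ g by rewrite exprn_gt0.
rewrite -(ler_pM2r xg) -exprMn -zE -exprM mulnC exprM.
apply: le_trans (hC g) _; set w := z ^+ g in Ng *.
have w0 : 0 < w by rewrite exprn_gt0 //; lra.
have hB1 : g.+2%:R <= B * (z * w) by rewrite /w -exprS; exact: hB.
have h3 : g.+2%:R ^+ 3 <= (B * (z * w)) ^+ 3.
  by apply: lerXn2r; rewrite ?nnegrE ?ler0n ?mulr_ge0 //; lra.
apply: le_trans (_ : (B * (z * w)) ^+ 3 * (C * z ^+ g.+2) <= _).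
  by rewrite ler_pM2r // mulr_gt0 ?exprn_gt0 //; lra.
have -> : (B * (z * w)) ^+ 3 * (C * z ^+ g.+2) = (B ^+ 3 * z ^+ 5 * C) * w ^+ 4.
  have -> : z ^+ g.+2 = z ^+ 2 * w by rewrite /w -exprD add2n.
  ring.
by rewrite [leRHS]exprS ler_wpM2r // exprn_ge0 // ltW.
Qed.

End final.

End UpperBound.

Local Open Scope ring_scope.
Local Open Scope ereal_scope.

Theorem theorem1p5 (R : realType) :
  [/\ (r151 R)%:E <= limsup_root R s_,
      limsup_root R s_ <= limsup_root R nhat_ &
      limsup_root R nhat_ <= (r154 R)%:E].
Proof. split; [exact: r151_le|exact: s_le_nhat|exact: nhat_le_r154]. Qed.
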